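(* Let $(\mathbf Y_k)_{k\ge1}$ be a finite independent sequence of random matrices in $\mathbb H^d$ that satisfy $$\mathbb E\,\mathbf Y_k=\mathbf 0\quad\text{and}\quad\|\mathbf Y_k\|\le R\ \text{ almost surely, for each index }k.$$ Then, for all $t\ge0$, $$\mathbb P\Big\{\lambda_{\max}\Big(\sum_k\mathbf Y_k\Big)\ge t\Big\}\le d\cdot\exp\Big\{\frac{-t^2}{3\sigma^2+2Rt}\Big\}\qquad\text{for }\ \sigma^2=\Big\|\sum_k\mathbb E\,\mathbf Y_k^2\Big\|.$$ Furthermore, $$\mathbb E\,\lambda_{\max}\Big(\sum_k\mathbf Y_k\Big)\le\sigma\sqrt{3\log d}+R\log d.$$
   Context: $\mathbb H^d$ is the space of $d\times d$ complex Hermitian matrices; $\lambda_{\max}$ is the largest eigenvalue; $\|\cdot\|$ is the spectral norm. *)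

(* Defs.v *)
From HB Require Import structures.
From mathcomp Require Export all_boot all_order all_algebra.
From mathcomp Require Export complex.
From mathcomp Require Export all_classical all_reals all_analysis.

Set Implicit Arguments.
Unset Strict Implicit.
Unset Printing Implicit Defensive.

Import Order.TTheory GRing.Theory Num.Theory.
Import numFieldNormedType.Exports.
Local Open Scope classical_set_scope.
Local Open Scope complex_scope.
Local Open Scope sesquilinear_scope.
Local Open Scope ring_scope.

(* The sigma-algebra on complex d x d matrices is the one generated by the real
   and imaginary parts of the entries, i.e. the Borel sigma-algebra of
   C^(d x d). *)
Definition mx_cylinders (R : realType) (d : nat) : set (set 'M[R[i]]_d) :=
  [set B | exists (i j : 'I_d) (A : set R), measurable A /\
    (B = [set M : 'M[R[i]]_d | A (complex.Re (M i j))] \/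
     B = [set M : 'M[R[i]]_d | A (complex.Im (M i j))])].

(* g_sigma_algebraType needs a pointed carrier. *)
HB.instance Definition _ (R : realType) := isPointed.Build R[i] 0.

HB.instance Definition _ (R : realType) (d : nat) :=
  Measurable.copy 'M[R[i]]_d (g_sigma_algebraType (@mx_cylinders R d)).

Definition mutually_independent (d d' : measure_display) (T : measurableType d)
    (T' : measurableType d') (R : realType) (P : probability T R) (n : nat)
    (X : 'I_n -> T -> T') : Prop :=
  forall (J : {set 'I_n}) (A : 'I_n -> set T'),
    (forall k, measurable (A k)) ->
    P (\bigcap_(k in [set` J]) (X k @^-1` A k)) =
    (\prod_(k in J) P (X k @^-1` A k))%E.

(* Entrywise expectation. Where an entry is not integrable, fine returns an
   arbitrary value; entries of almost surely bounded matrices are integrable. *)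
Definition expectation_mx (d0 : measure_display) (T : measurableType d0)
    (R : realType) (P : probability T R) (d : nat) (Y : T -> 'M[R[i]]_d) :
    'M[R[i]]_d :=
  \matrix_(i, j) (fine ('E_P[fun w => complex.Re (Y w i j)])%E
               +i* fine ('E_P[fun w => complex.Im (Y w i j)])%E).

(* The supremum is over a finite set, so it is a maximum as soon as A has a real
   eigenvalue; in particular for A Hermitian and d > 0. *)
Definition lambda_max (R : realType) (d : nat) (A : 'M[R[i]]_d) : R :=
  sup [set x : R | eigenvalue A x%:C].

(* The largest singular value: the square root of the largest eigenvalue of
   A^* A. *)
Definition spectral_norm (R : realType) (d : nat) (A : 'M[R[i]]_d) : R :=
  Num.sqrt (lambda_max (A^t* *m A)).

(* Main.v *)
Require Import Defs.
From HB Require Import structures.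
From mathcomp Require Import all_boot all_order all_algebra.
From mathcomp Require Import complex.
From mathcomp Require Import all_classical all_reals all_analysis.
From mathcomp Require Import measurable_realfun ring lra.

Set Implicit Arguments.
Unset Strict Implicit.
Unset Printing Implicit Defensive.

Import Order.TTheory GRing.Theory Num.Theory.
Import numFieldNormedType.Exports.
Local Open Scope classical_set_scope.
Local Open Scope ring_scope.
Local Open Scope sesquilinear_scope.

(** Let X = \sum_k Y_k and m(th) = E tr exp(th X). The method of exchangeable
    pairs bounds m' without Lieb's theorem: replacing Y_k by an independent copy
    Y_k' turns E tr Y_k exp(th X) into half of
    E tr (Y_k - Y_k') (exp(th X) - exp(th X')), and the mean value trace
    inequality bounds this by (th / 2) E tr (Y_k^2 + E Y_k^2) exp(th X). The same
    device applied to Y_k^2 / L gives S - V <= th L (S + V), where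
    S = \sum_k E tr Y_k^2 exp(th X) and V = \sum_k E tr (E Y_k^2) exp(th X),
    and V <= sigma^2 m. Hence (1 - th L) m' <= th sigma^2 m, so that
    m(th) <= d exp(th^2 sigma^2 / (2 (1 - th L))), and both claims follow from
    the Laplace transform method.

    No joint law of the Y_k and their copies is needed: the differential
    inequality is proved for independent matrices with finitely many values, and
    reaches the Y_k by replacing each of them by its conditional expectation on
    the cells of a grid. This preserves independence, centering and (by Jensen)
    the bounds L and sigma^2, and perturbs lambda_max(X) by O(mesh). *)

(** * Spectral calculus and the mean value trace inequality *)

Section ComplexParts.
Variable R : realType.
Implicit Types z w : R[i].

Lemma Re_add z w : complex.Re (z + w) = complex.Re z + complex.Re w.
Proof. by case: z w => [a b] [c e]. Qed.

Lemma Im_add z w : complex.Im (z + w) = complex.Im z + complex.Im w.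
Proof. by case: z w => [a b] [c e]. Qed.

Lemma Re_mul z w : complex.Re (z * w) =
  complex.Re z * complex.Re w - complex.Im z * complex.Im w.
Proof. by case: z w => [a b] [c e]. Qed.

Lemma Im_mul z w : complex.Im (z * w) =
  complex.Re z * complex.Im w + complex.Im z * complex.Re w.
Proof. by case: z w => [a b] [c e]. Qed.

Lemma Re_sum (I : Type) (r : seq I) (Q : pred I) (F : I -> R[i]) :
  complex.Re (\sum_(i <- r | Q i) F i) = \sum_(i <- r | Q i) complex.Re (F i).
Proof. exact: (big_morph _ Re_add). Qed.

Lemma Im_sum (I : Type) (r : seq I) (Q : pred I) (F : I -> R[i]) :
  complex.Im (\sum_(i <- r | Q i) F i) = \sum_(i <- r | Q i) complex.Im (F i).
Proof. exact: (big_morph _ Im_add). Qed.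

Lemma complex_Re_conj z : complex.Re (Num.conj z) = complex.Re z.
Proof. by case: z. Qed.

Lemma complex_Im_conj z : complex.Im (Num.conj z) = - complex.Im z.
Proof. by case: z. Qed.

Lemma complexP z w : complex.Re z = complex.Re w ->
  complex.Im z = complex.Im w -> z = w.
Proof. by case: z w => [a b] [c e] /= -> ->. Qed.

(** The squared modulus, with values in [R], whereas the norm of [R[i]] takes values in [R[i]]. *)
Definition sqn z : R := complex.Re z ^+ 2 + complex.Im z ^+ 2.

Lemma sqn_ge0 z : 0 <= sqn z.
Proof. by rewrite addr_ge0 ?sqr_ge0. Qed.

Lemma sqnM z w : sqn (z * w) = sqn z * sqn w.
Proof. rewrite /sqn Re_mul Im_mul; ring. Qed.

Lemma sqn_real (c : R) : sqn c%:C%C = c ^+ 2.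
Proof. by rewrite /sqn /= expr0n addr0. Qed.

Lemma mul_conj z : z * Num.conj z = (sqn z)%:C%C.
Proof.
by apply: complexP; rewrite ?(Re_mul, Im_mul) complex_Re_conj complex_Im_conj /sqn /=; ring.
Qed.

Lemma Re_mul_le z w : `|complex.Re (z * w)| <= (sqn z + sqn w) / 2.
Proof.
have := sqr_ge0 (complex.Re z - complex.Re w).
have := sqr_ge0 (complex.Re z + complex.Re w).
have := sqr_ge0 (complex.Im z - complex.Im w).
have := sqr_ge0 (complex.Im z + complex.Im w).
by rewrite /sqn Re_mul ler_norml; nra.
Qed.

Lemma Im_mul_le z w : `|complex.Im (z * w)| <= (sqn z + sqn w) / 2.
Proof.
have := sqr_ge0 (complex.Re z - complex.Im w).
have := sqr_ge0 (complex.Re z + complex.Im w).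
have := sqr_ge0 (complex.Im z - complex.Re w).
have := sqr_ge0 (complex.Im z + complex.Re w).
by rewrite /sqn Im_mul ler_norml; nra.
Qed.

End ComplexParts.

(** * Quadratic forms and the Loewner order *)

Section QuadraticForms.
Variables (R : realType) (d : nat).
Local Notation C := R[i].
Implicit Types (x : 'rV[C]_d) (M N H : 'M[C]_d).

(** Vectors are rows and matrices act from the right, as in [eigenvalue] and [spectralmx]. *)
Definition nrm2 (n : nat) (x : 'rV[C]_n) : R := \sum_j sqn (x 0 j).

Definition qf x M : R := complex.Re ((x *m M *m x^t*) 0 0).

(** For Hermitian M this is positive semidefiniteness, and [psd (N - M)] is the Loewner order. Since
    [qf] takes a real part, no Hermitian side condition has to be carried along. *)
Definition psd M := forall x, 0 <= qf x M.

Lemma nrm2_ge0 n (x : 'rV[C]_n) : 0 <= nrm2 x.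
Proof. by apply: sumr_ge0 => j _; apply: sqn_ge0. Qed.

Lemma mulmx_adj_nrm2 n (x : 'rV[C]_n) : (x *m x^t*) 0 0 = (nrm2 x)%:C%C.
Proof.
rewrite mxE rmorph_sum; apply: eq_bigr => j _.
by rewrite !mxE mul_conj.
Qed.

Lemma nrm2_unitary x (U : 'M[C]_d) : U \is unitarymx -> nrm2 (x *m U) = nrm2 x.
Proof.
move=> /unitarymxP UU; apply: complexI; rewrite -!mulmx_adj_nrm2.
by rewrite trmx_mul map_mxM mulmxA -(mulmxA x) UU mulmx1.
Qed.

Lemma nrm2_eq0 x : nrm2 x = 0 -> x = 0.
Proof.
move=> x0; apply/rowP => j; rewrite mxE; apply/eqP.
have /eqP := x0; rewrite psumr_eq0 => [/allP/(_ j)|k _]; last exact: sqn_ge0.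
rewrite mem_index_enum /sqn => /(_ isT).
rewrite /= paddr_eq0 ?sqr_ge0 // !sqrf_eq0 => /andP[/eqP re /eqP im].
by apply/eqP; apply: complexP.
Qed.

Lemma adjD M N : (M + N)^t* = M^t* + N^t*.
Proof. by rewrite linearD /= map_mxD. Qed.

Lemma adjM (m n p : nat) (M : 'M[C]_(m, n)) (N : 'M[C]_(n, p)) :
  (M *m N)^t* = N^t* *m M^t*.
Proof. by rewrite trmx_mul map_mxM. Qed.

Lemma hermP M : reflect (M^t* = M) (M \is hermsymmx).
Proof.
apply: (iffP (is_hermitianmxP _ _ _)); rewrite expr0 scale1r => e.
  by rewrite -e.
by rewrite e.
Qed.

Lemma qfD x M N : qf x (M + N) = qf x M + qf x N.
Proof. by rewrite /qf mulmxDr mulmxDl mxE Re_add. Qed.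

Lemma qfZ x (c : R) M : qf x (c%:C%C *: M) = c * qf x M.
Proof. by rewrite /qf -scalemxAr -scalemxAl mxE Re_mul /= mul0r subr0. Qed.

Lemma qf0 x : qf x 0 = 0.
Proof. by rewrite /qf mulmx0 mul0mx mxE. Qed.

Lemma qfN x M : qf x (- M) = - qf x M.
Proof. by apply/eqP; rewrite -addr_eq0 -qfD addNr qf0. Qed.

Lemma qfB x M N : qf x (M - N) = qf x M - qf x N.
Proof. by rewrite qfD qfN. Qed.

Lemma qf_sum x (I : Type) (r : seq I) (Q : pred I) (F : I -> 'M[C]_d) :
  qf x (\sum_(i <- r | Q i) F i) = \sum_(i <- r | Q i) qf x (F i).
Proof. by apply: (big_morph (qf x)); [exact: qfD|exact: qf0]. Qed.

Lemma qf1 x : qf x 1%:M = nrm2 x.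
Proof. by rewrite /qf mulmx1 mulmx_adj_nrm2. Qed.

Lemma qf_scalar x (c : R) : qf x (c%:C%C)%:M = c * nrm2 x.
Proof. by rewrite -qf1 -qfZ scalemx1. Qed.

Lemma qf_congr x M N : qf x (N *m M *m N^t*) = qf (x *m N) M.
Proof. by rewrite /qf adjM !mulmxA. Qed.

Lemma qf_sq x M : M^t* = M -> qf x (M *m M) = nrm2 (x *m M).
Proof.
move=> hM; have -> : M *m M = M *m 1%:M *m M^t* by rewrite hM mulmx1.
by rewrite qf_congr qf1.
Qed.

Lemma qf_entry (U M : 'M[C]_d) i :
  qf (row i U) M = complex.Re ((U *m M *m U^t*) i i).
Proof.
rewrite /qf; congr complex.Re.
rewrite -row_mul [LHS]mxE [RHS]mxE; apply: eq_bigr => k _.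
by rewrite !mxE.
Qed.

End QuadraticForms.

(** * Trace exponentials in a spectral basis *)

Section Spectral.
Variables (R : realType) (d : nat).
Local Notation C := R[i].
Implicit Types (x : 'rV[C]_d) (M N H A B : 'M[C]_d).

Definition eig H (i : 'I_d) : R := complex.Re (spectral_diag H 0 i).

Lemma spectral_decomp H : H^t* = H ->
  H = (spectralmx H)^t* *m diag_mx (\row_i (eig H i)%:C%C) *m spectralmx H.
Proof.
move=> hH; have Hh : H \is hermsymmx by apply/hermP.
have /orthomx_spectralP := hermitian_normalmx Hh.
rewrite invmx_unitary ?spectral_unitarymx // => {1}->.
congr (_ *m diag_mx _ *m _); apply/rowP => i; rewrite mxE /eig RRe_real //.
by have /mxOverP := hermitian_spectral_diag_real Hh; apply.
Qed.

Lemma spectral_row H i : H^t* = H ->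
  row i (spectralmx H) *m H = (eig H i)%:C%C *: row i (spectralmx H).
Proof.
move=> hH; set U := spectralmx H.
have /unitarymxP UU : U \is unitarymx by exact: spectral_unitarymx.
have UH : U *m H = diag_mx (\row_j (eig H j)%:C%C) *m U.
  by rewrite [X in _ *m X = _](spectral_decomp hH) -/U !mulmxA UU mul1mx.
rewrite -row_mul UH mul_diag_mx.
by apply/rowP => j; rewrite !mxE.
Qed.

Lemma nrm2_spectral_row H i : nrm2 (row i (spectralmx H)) = 1.
Proof.
rewrite -qf1 qf_entry mulmx1.
have /unitarymxP -> : spectralmx H \is unitarymx by exact: spectral_unitarymx.
by rewrite !mxE eqxx.
Qed.

(* The real part of tr (M exp(th H)), computed in a spectral basis of H. *)
Definition trexp (th : R) M H : R :=
  \sum_i expR (th * eig H i) * qf (row i (spectralmx H)) M.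

Lemma trexpD th M N H : trexp th (M + N) H = trexp th M H + trexp th N H.
Proof. by rewrite /trexp -big_split; apply: eq_bigr => i _; rewrite qfD mulrDr. Qed.

Lemma trexpZ th (c : R) M H : trexp th (c%:C%C *: M) H = c * trexp th M H.
Proof.
by rewrite /trexp mulr_sumr; apply: eq_bigr => i _; rewrite qfZ mulrCA.
Qed.

Lemma trexp0 th H : trexp th 0 H = 0.
Proof. by apply: big1 => i _; rewrite qf0 mulr0. Qed.

Lemma trexpN th M H : trexp th (- M) H = - trexp th M H.
Proof. by apply/eqP; rewrite -addr_eq0 -trexpD addNr trexp0. Qed.

Lemma trexpB th M N H : trexp th (M - N) H = trexp th M H - trexp th N H.
Proof. by rewrite trexpD trexpN. Qed.

Lemma trexp_sum th H (I : Type) (r : seq I) (Q : pred I) (F : I -> 'M[C]_d) :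
  trexp th (\sum_(i <- r | Q i) F i) H = \sum_(i <- r | Q i) trexp th (F i) H.
Proof.
apply: (big_morph (fun M => trexp th M H)); last exact: trexp0.
by move=> M N; exact: trexpD.
Qed.

Lemma trexp_ge0 th M H : psd M -> 0 <= trexp th M H.
Proof. by move=> M0; apply: sumr_ge0 => i _; rewrite mulr_ge0 ?expR_ge0. Qed.

Lemma ler_trexp th M N H : psd (N - M) -> trexp th M H <= trexp th N H.
Proof. by move=> MN; rewrite -subr_ge0 -trexpB trexp_ge0. Qed.

Lemma trexp1 th H : trexp th 1%:M H = \sum_i expR (th * eig H i).
Proof. by apply: eq_bigr => i _; rewrite qf1 nrm2_spectral_row mulr1. Qed.

Lemma trexp_self th H : H^t* = H ->
  trexp th H H = \sum_i expR (th * eig H i) * eig H i.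
Proof.
move=> hH; apply: eq_bigr => i _; congr *%R.
by rewrite /qf spectral_row // -/(qf _ _) -scalemxAl mxE mulmx_adj_nrm2
  nrm2_spectral_row Re_mul /= mulr1 mul0r subr0.
Qed.

(** Convexity of exp: its integral over [y, x] is at most the area of the trapezoid. *)
Lemma expR_trapezoid_le (x y : R) : y <= x ->
  expR x - expR y <= (x - y) * ((expR x + expR y) / 2).
Proof.
move=> yx; have s0 : 0 <= x - y by rewrite subr_ge0.
(* Factoring out exp y reduces to an interval starting at 0. *)
suff h (s : R) : 0 <= s -> expR s - 1 <= s * ((expR s + 1) / 2).
  rewrite -[x in expR x](subrK y) expRD.
  have := ler_wpM2r (expR_ge0 y) (h _ s0).
  rewrite mulrBl mul1r => /le_trans; apply; rewrite le_eqVlt; apply/orP; left.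
  by apply/eqP; ring.
pose g (u : R) := expR u - 1 - u * ((expR u + 1) / 2).
pose g' (u : R) := expR u - ((expR u + 1) / 2 + u * (expR u / 2)).
have dg (u : R) : is_derive u 1 g (g' u).
  rewrite /g; apply: is_derive_eq.
  by rewrite /g' /GRing.scale /=; field.
move=> s_ge0; rewrite -subr_le0 -/(g s).
have g0 : g 0 = 0 by rewrite /g expR0; ring.
rewrite -g0; move: s_ge0; rewrite le_eqVlt => /predU1P[<- //|s_gt0].
apply: (@ler0_derive1_le_cc _ g 0 s) => //.
- move=> u; rewrite in_itv /= => /andP[u0 us].
  rewrite derive1E (@derive_val _ _ _ _ _ _ _ (dg u)) /g'.
  (* g' u equals (exp(u) (1 - u) - 1) / 2, which is nonpositive because exp(-u) >= 1 - u. *)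
  have := expR_ge1Dx (- u); rewrite expRN => h.
  have := ler_wpM2l (expR_ge0 u) h; rewrite mulfV ?gt_eqF ?expR_gt0 //.
  by lra.
- apply: derivable_within_continuous => u _; exact: (@ex_derive _ _ _ _ _ _ _ (dg u)).
- by rewrite in_itv /= lexx ltW.
- by rewrite in_itv /= lexx ltW.
- exact: ltW.
Qed.

(* With q = <u, v> and z = <v, C u>, this is AM-GM for the summand of
   [trexp_mean_value] attached to eigenvectors u of A and v of B. *)
Lemma expR_mean_value_term (th a b : R) (q z : C) : 0 <= th ->
  (expR (th * a) - expR (th * b)) * complex.Re (q * z) <=
  th / 4 * ((sqn z + (a - b) ^+ 2 * sqn q) * (expR (th * a) + expR (th * b))).
Proof.
move=> th0.
(* The absolute value makes the case b' <= a' sufficient: exchanging a and b flips the sign of the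
   first factor only. *)
have main (a' b' : R) (z' : C) : b' <= a' ->
  (expR (th * a') - expR (th * b')) * `|complex.Re (q * z')| <=
  th / 4 * ((sqn z' + (a' - b') ^+ 2 * sqn q) * (expR (th * a') + expR (th * b'))).
  move=> ba; have tba : th * b' <= th * a' by rewrite ler_wpM2l.
  have E := expR_trapezoid_le tba.
  apply: (le_trans (ler_wpM2r (normr_ge0 _) E)).
  have sab : 0 <= a' - b' by rewrite subr_ge0.
  have h : (a' - b') * `|complex.Re (q * z')| <=
      (sqn z' + (a' - b') ^+ 2 * sqn q) / 2.
    rewrite -{1}(ger0_norm sab) -normrM.
    have -> : (a' - b') * complex.Re (q * z') =
        complex.Re (((a' - b')%:C%C * q) * z').
      by rewrite !Re_mul !Im_mul /=; ring.
    apply: (le_trans (Re_mul_le _ _)); rewrite sqnM.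
    by rewrite sqn_real addrC.
  have pos : 0 <= th * ((expR (th * a') + expR (th * b')) / 2).
    by rewrite mulr_ge0 // divr_ge0 // addr_ge0 ?expR_ge0.
  move: (ler_wpM2l pos h).
  set e1 := expR _; set e2 := expR _; set u := `|_|; set v := sqn _; set w := sqn _.
  by move=> {}h; lra.
have [ba|ab] := leP b a.
  apply: le_trans (main _ _ _ ba); rewrite ler_wpM2l ?ler_norm //.
  by rewrite subr_ge0 ler_expR ler_wpM2l.
have H := main _ _ z (ltW ab).
rewrite -[(b - a) ^+ 2]sqrrN opprB (addrC (expR (th * b)) (expR _)) in H.
apply: le_trans H; rewrite -mulrNN opprB ler_wpM2l //.
  by rewrite subr_ge0 ler_expR ler_wpM2l // ltW.
by rewrite -normrN ler_norm.
Qed.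

(** Parseval: multiplication by V^* preserves the norm of row i of U M, and for Hermitian M the
    square of that norm is the form of M^2. *)
Lemma sum_sqn_unitary M (U V : 'M[C]_d) : U \is unitarymx -> V \is unitarymx -> M^t* = M ->
  forall i, \sum_j sqn ((U *m M *m V^t*) i j) = qf (row i U) (M *m M).
Proof.
move=> Uu Vu hM i; rewrite qf_sq //.
rewrite -(nrm2_unitary _ (U := V^t*)) ?trmxC_unitary //.
by rewrite -!row_mul; apply: eq_bigr => j _; rewrite [in RHS]mxE.
Qed.

(** Both sides become double sums over an eigenvector of A and an eigenvector of B, and are compared
    term by term with [expR_mean_value_term]. *)
Lemma trexp_mean_value th C A B : 0 <= th -> C^t* = C -> A^t* = A -> B^t* = B ->
  trexp th C A - trexp th C B <=
  th / 4 * (trexp th (C *m C + (A - B) *m (A - B)) A +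
            trexp th (C *m C + (A - B) *m (A - B)) B).
Proof.
move=> th0 hC hA hB.
set U := spectralmx A; set V := spectralmx B.
have Uu : U \is unitarymx by exact: spectral_unitarymx.
have Vu : V \is unitarymx by exact: spectral_unitarymx.
have UU := unitarymxP Uu; have VV := unitarymxP Vu.
have U'U : U^t* *m U = 1%:M.
  by rewrite -invmx_unitary // mulVmx // unitarymx_unit.
have V'V : V^t* *m V = 1%:M.
  by rewrite -invmx_unitary // mulVmx // unitarymx_unit.
(* Q holds the overlaps of the two eigenbases, N the matrix C written between them. *)
pose Q := U *m V^t*; pose N := V *m C *m U^t*.
(* Between the two eigenbases A - B acts entrywise, as multiplication by a difference of
   eigenvalues. *)
have EQ i j : (U *m (A - B) *m V^t*) i j = (eig A i - eig B j)%:C%C * Q i j.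
  have -> : U *m (A - B) *m V^t* =
      diag_mx (\row_i (eig A i)%:C%C) *m Q - Q *m diag_mx (\row_i (eig B i)%:C%C).
    rewrite mulmxBr mulmxBl; congr (_ - _).
      rewrite {1}(spectral_decomp hA) -/U /Q !mulmxA UU mul1mx //.
    by rewrite {1}(spectral_decomp hB) -/V /Q -!mulmxA VV mulmx1.
  rewrite mxE mul_diag_mx mul_mx_diag !mxE rmorphB /=; ring.
have sA i : \sum_j sqn (N j i) = qf (row i U) (C *m C).
  rewrite -(sum_sqn_unitary Uu Vu hC); apply: eq_bigr => j _.
  have -> : U *m C *m V^t* = N^t* by rewrite /N !adjM trmxCK hC mulmxA.
  by rewrite !mxE /sqn complex_Re_conj complex_Im_conj sqrrN.
have sB j : \sum_i sqn (N j i) = qf (row j V) (C *m C).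
  by rewrite -(sum_sqn_unitary Vu Uu hC).
have hAB : (A - B)^t* = A - B by rewrite linearB map_mxB hA hB.
have sqE i j : sqn ((U *m (A - B) *m V^t*) i j) =
    (eig A i - eig B j) ^+ 2 * sqn (Q i j).
  by rewrite EQ sqnM sqn_real.
have tA i : \sum_j (eig A i - eig B j) ^+ 2 * sqn (Q i j) =
    qf (row i U) ((A - B) *m (A - B)).
  by rewrite -(sum_sqn_unitary Uu Vu hAB); apply: eq_bigr => j _; rewrite sqE.
have tB j : \sum_i (eig A i - eig B j) ^+ 2 * sqn (Q i j) =
    qf (row j V) ((A - B) *m (A - B)).
  rewrite -(sum_sqn_unitary Vu Uu hAB); apply: eq_bigr => i _.
  rewrite -sqE.
  have -> : V *m (A - B) *m U^t* = (U *m (A - B) *m V^t*)^t*.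
    by rewrite !adjM trmxCK hAB mulmxA.
  by rewrite [in RHS]mxE [in RHS]mxE /sqn complex_Re_conj complex_Im_conj sqrrN.
(* Inserting V^* V = 1 spreads a diagonal entry of C in the basis of A over the basis of B. *)
have eA i : qf (row i U) C = \sum_j complex.Re (Q i j * N j i).
  rewrite qf_entry -Re_sum; congr complex.Re.
  have -> : U *m C *m U^t* = Q *m N.
    by rewrite /Q /N !mulmxA -(mulmxA U (V^t*) V) V'V mulmx1.
  by rewrite mxE.
have eB j : qf (row j V) C = \sum_i complex.Re (Q i j * N j i).
  rewrite qf_entry -Re_sum; congr complex.Re.
  have -> : V *m C *m V^t* = N *m Q.
    by rewrite /Q /N !mulmxA -(mulmxA (V *m C) (U^t*) U) U'U mulmx1.
  by rewrite mxE; apply: eq_bigr => i _; rewrite mulrC.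
have L : trexp th C A - trexp th C B = \sum_i \sum_j
    (expR (th * eig A i) - expR (th * eig B j)) * complex.Re (Q i j * N j i).
  rewrite {2}/trexp -/V.
  under [X in _ - X]eq_bigr => j _ do rewrite eB mulr_sumr.
  rewrite exchange_big /= /trexp -sumrB; apply: eq_bigr => i _.
  rewrite eA mulr_sumr -sumrB; apply: eq_bigr => j _.
  by rewrite mulrBl.
have Rr : trexp th (C *m C + (A - B) *m (A - B)) A +
            trexp th (C *m C + (A - B) *m (A - B)) B = \sum_i \sum_j
    (sqn (N j i) + (eig A i - eig B j) ^+ 2 * sqn (Q i j)) *
    (expR (th * eig A i) + expR (th * eig B j)).
  rewrite {2}/trexp -/V.
  under [X in _ + X]eq_bigr => j _ do rewrite qfD -sB -tB -big_split mulr_sumr.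
  rewrite exchange_big /= /trexp -big_split /=; apply: eq_bigr => i _.
  rewrite qfD -sA -tA -big_split mulr_sumr -big_split /=; apply: eq_bigr => j _.
  by rewrite [RHS]mulrDr mulrC [X in _ + X = _]mulrC.
rewrite L Rr mulr_sumr; apply: ler_sum => i _; rewrite mulr_sumr.
by apply: ler_sum => j _; exact: expR_mean_value_term.
Qed.

End Spectral.

(** * Finitely supported independent matrices *)

Lemma is_derive_bigsum (R : realType) (J : Type) (r : seq J)
    (F : J -> R -> R) (F' : J -> R) (t : R) :
  (forall j, is_derive t 1 (F j) (F' j)) ->
  is_derive t 1 (fun u => \sum_(j <- r) F j u) (\sum_(j <- r) F' j).
Proof.
move=> dF; elim: r => [|j r IH].
  under eq_fun do rewrite big_nil; rewrite big_nil; exact: is_derive_cst.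
under eq_fun do rewrite big_cons; rewrite big_cons.
exact: (is_deriveD (dF j) IH).
Qed.

(* m := \sum_j c_j exp(th e_j) satisfies m' <= K th m, so m exp(-K th^2 / 2) is
   nonincreasing. *)
Lemma exp_sum_gronwall (R : realType) (J : finType) (c e : J -> R) (K th0 : R) :
  0 <= th0 ->
  (forall th, 0 < th < th0 ->
    \sum_j c j * (expR (th * e j) * e j) <=
    K * th * \sum_j c j * expR (th * e j)) ->
  \sum_j c j * expR (th0 * e j) <= expR (K * th0 ^+ 2 / 2) * \sum_j c j.
Proof.
rewrite le_eqVlt => /predU1P[<- _|th_gt0 H].
  by rewrite expr0n mulr0 mul0r expR0 mul1r; apply/ler_sum => j _;
    rewrite mul0r expR0 mulr1.
pose h (u : R) := \sum_j c j * expR (u * e j - K * u ^+ 2 / 2).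
pose h' (u : R) := \sum_j c j * (expR (u * e j - K * u ^+ 2 / 2) * (e j - K * u)).
have dh (u : R) : is_derive u 1 h (h' u).
  apply: is_derive_bigsum => j; apply: is_derive_eq.
  by rewrite /GRing.scale /=; field.
have hle : h th0 <= h 0.
  apply: (@ler0_derive1_le_cc _ h 0 th0) => //.
  - move=> u; rewrite in_itv /= => uI.
    rewrite derive1E (@derive_val _ _ _ _ _ _ _ (dh u)) /h'.
    have -> : \sum_j c j * (expR (u * e j - K * u ^+ 2 / 2) * (e j - K * u)) =
        expR (- (K * u ^+ 2 / 2)) * (\sum_j c j * (expR (u * e j) * e j) -
          K * u * \sum_j c j * expR (u * e j)).
      rewrite [X in _ - X]mulr_sumr -sumrB mulr_sumr; apply: eq_bigr => j _.
      by rewrite expRD; ring.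
    by rewrite mulr_ge0_le0 ?expR_ge0 // subr_le0 H.
  - apply: derivable_within_continuous => u _.
    exact: (@ex_derive _ _ _ _ _ _ _ (dh u)).
  - by rewrite in_itv /= lexx ltW.
  - by rewrite in_itv /= lexx ltW.
  - exact: ltW.
have -> : \sum_j c j * expR (th0 * e j) = expR (K * th0 ^+ 2 / 2) * h th0.
  rewrite mulr_sumr; apply: eq_bigr => j _.
  by rewrite mulrCA -expRD addrCA subrr addr0.
rewrite ler_wpM2l ?expR_ge0 //; apply: le_trans hle _.
apply: ler_sum => j _.
by rewrite mul0r expr0n mulr0 mul0r subr0 expR0 mulr1.
Qed.

(** Regroups the expansion of c (v - w)^2 for [mean_sqB], with the four matrix products as atoms. *)
Lemma scaler_expand (K : pzRingType) (V : lmodType K) (c : K) (x y z t : V) :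
  c *: (x - y - (z - t)) = c *: x - c *: z - c *: y + c *: t.
Proof. by rewrite !scalerBr opprB addrA addrAC [X in X + _]addrAC. Qed.

Section NormBounds.
Variables (R : realType) (d : nat).
Local Notation C := R[i].
Implicit Types (x y : 'rV[C]_d) (M N : 'M[C]_d).

Lemma nrm2B_le x y : nrm2 (x - y) <= 2 * nrm2 x + 2 * nrm2 y.
Proof.
rewrite !mulr_sumr -big_split; apply: ler_sum => j _; rewrite !mxE.
rewrite /sqn; case: (x 0 j) => a b; case: (y 0 j) => a' b' /=.
have := sqr_ge0 (a + a'); have := sqr_ge0 (b + b'); nra.
Qed.

Lemma nrm2Z (c : R) x : nrm2 (c%:C%C *: x) = c ^+ 2 * nrm2 x.
Proof.
rewrite mulr_sumr; apply: eq_bigr => j _.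
by rewrite mxE sqnM sqn_real.
Qed.

Lemma hermB M N : M^t* = M -> N^t* = N -> (M - N)^t* = M - N.
Proof. by move=> hM hN; rewrite linearB map_mxB hM hN. Qed.

Lemma herm_sq M : M^t* = M -> (M *m M)^t* = M *m M.
Proof. by move=> hM; rewrite adjM hM. Qed.

Lemma hermZ (c : R) M : M^t* = M -> (c%:C%C *: M)^t* = c%:C%C *: M.
Proof.
move=> hM; apply/matrixP => i j; rewrite !mxE rmorphM /=.
have := congr1 (fun M => M i j) hM; rewrite !mxE => ->.
by congr (_ * _); apply: complexP => //=; rewrite oppr0.
Qed.

Lemma herm_sum (I : Type) (r : seq I) (Q : pred I) (F : I -> 'M[C]_d) :
  (forall i, (F i)^t* = F i) ->
  (\sum_(i <- r | Q i) F i)^t* = \sum_(i <- r | Q i) F i.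
Proof.
move=> hF; have -> : (\sum_(i <- r | Q i) F i)^t* = \sum_(i <- r | Q i) (F i)^t*.
  apply: (big_morph (fun M => M^t*)); first exact: adjD.
  by rewrite trmx0 map_mx0.
by apply: eq_bigr => i _; exact: hF.
Qed.

Lemma psd_sq M : M^t* = M -> psd (M *m M).
Proof. by move=> hM x; rewrite qf_sq // nrm2_ge0. Qed.

(** The order relation M^2 <= L^2 read as an operator norm bound. *)
Lemma nrm2_le_of_psd L M : M^t* = M -> psd ((L ^+ 2)%:C%C%:M - M *m M) ->
  forall x, nrm2 (x *m M) <= L ^+ 2 * nrm2 x.
Proof.
by move=> hM H x; have := H x; rewrite qfB qf_scalar qf_sq // subr_ge0.
Qed.

End NormBounds.

(** * Exchangeable pairs on a finite product space *)

Section FiniteModel.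
Variables (R : realType) (d n : nat) (A : finType).
Local Notation C := R[i].
Variables (p : 'I_n -> A -> R) (v : 'I_n -> A -> 'M[C]_d) (L s2 : R).
Hypothesis p_ge0 : forall k a, 0 <= p k a.
Hypothesis p_sum1 : forall k, \sum_a p k a = 1.
Hypothesis v_herm : forall k a, (v k a)^t* = v k a.
Hypothesis v_centered : forall k, \sum_a (p k a)%:C%C *: v k a = 0.
Hypothesis L_ge0 : 0 <= L.
Hypothesis v_bound : forall k a, psd ((L ^+ 2)%:C%C%:M - v k a *m v k a).
Hypothesis s2_ge0 : 0 <= s2.
Hypothesis v_var :
  psd (s2%:C%C%:M - \sum_k \sum_a (p k a)%:C%C *: (v k a *m v k a)).

Implicit Types (x : {ffun 'I_n -> A}) (k : 'I_n) (a b : A).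

(** A product of marginals: this is how the finite model encodes independence. *)
Definition weight x : R := \prod_k p k (x k).
Definition total x : 'M[C]_d := \sum_k v k (x k).
Definition upd k x b : {ffun 'I_n -> A} := [ffun j => if j == k then b else x j].

Lemma weight_ge0 x : 0 <= weight x.
Proof. by apply: prodr_ge0 => k _. Qed.

Lemma weight_sum1 : \sum_x weight x = 1.
Proof.
by rewrite -(bigA_distr_bigA p) /=; apply: big1 => k _; exact: p_sum1.
Qed.

Lemma upd_at k x b : upd k x b k = b.
Proof. by rewrite ffunE eqxx. Qed.

Lemma upd_upd k x b : upd k (upd k x b) (x k) = x.
Proof. by apply/ffunP => j; rewrite !ffunE; case: eqP => [->|]. Qed.

Lemma weight_upd k x b : weight (upd k x b) * p k (x k) = weight x * p k b.
Proof.
rewrite /weight (bigD1 k) //= [in RHS](bigD1 k) //= upd_at.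
under eq_bigr => j /negPf jk do rewrite ffunE jk.
ring.
Qed.

Lemma total_upd k x b : total x - total (upd k x b) = v k (x k) - v k b.
Proof.
rewrite /total (bigD1 k) //= [X in _ - X](bigD1 k) //= upd_at.
under [X in _ - (_ + X)]eq_bigr => j /negPf jk do rewrite ffunE jk.
by rewrite opprD addrACA subrr addr0.
Qed.

Lemma total_herm x : (total x)^t* = total x.
Proof. exact: herm_sum. Qed.

(** The expectation over an outcome x and an independent copy b of its k-th coordinate; x and
    [upd k x b] then form the exchangeable pair. *)
Definition mean2 k (G : {ffun 'I_n -> A} -> A -> R) : R :=
  \sum_x \sum_b weight x * p k b * G x b.

(** Exchangeability: trading x k for b is an involution on the pairs (x, b), and it preserves their
    joint weight. *)
Lemma mean2_swap k G : mean2 k G = mean2 k (fun x b => G (upd k x b) (x k)).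
Proof.
rewrite /mean2 !pair_big /=.
rewrite (reindex_inj (h := fun u => (upd k u.1 u.2, u.1 k))) /=; last first.
  apply: (@can_inj _ _ _ (fun u => (upd k u.1 u.2, u.1 k))) => -[x b] /=.
  by rewrite upd_upd upd_at.
by apply: eq_bigr => -[x b] _ /=; rewrite weight_upd.
Qed.

Lemma eq_mean2 k G G' : (forall x b, G x b = G' x b) -> mean2 k G = mean2 k G'.
Proof. by move=> GG'; apply: eq_bigr => x _; apply: eq_bigr => b _; rewrite GG'. Qed.

Lemma mean2D k G G' : mean2 k (fun x b => G x b + G' x b) = mean2 k G + mean2 k G'.
Proof.
rewrite /mean2 -big_split; apply: eq_bigr => x _; rewrite -big_split.
by apply: eq_bigr => b _; rewrite mulrDr.
Qed.

Lemma mean2Z k c G : mean2 k (fun x b => c * G x b) = c * mean2 k G.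
Proof.
rewrite /mean2 mulr_sumr; apply: eq_bigr => x _; rewrite mulr_sumr.
by apply: eq_bigr => b _; rewrite mulrCA.
Qed.

Lemma ler_mean2 k G G' : (forall x b, G x b <= G' x b) -> mean2 k G <= mean2 k G'.
Proof.
move=> GG'; apply: ler_sum => x _; apply: ler_sum => b _.
by rewrite ler_wpM2l // mulr_ge0 // weight_ge0.
Qed.

Definition var k : 'M[C]_d := \sum_a (p k a)%:C%C *: (v k a *m v k a).

Lemma mean2_trexp k th (F : {ffun 'I_n -> A} -> A -> 'M[C]_d) :
  mean2 k (fun x b => trexp th (F x b) (total x)) =
  \sum_x weight x * trexp th (\sum_b (p k b)%:C%C *: F x b) (total x).
Proof.
apply: eq_bigr => x _; rewrite trexp_sum mulr_sumr; apply: eq_bigr => b _.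
by rewrite trexpZ mulrA.
Qed.

Lemma mean_const k (M : 'M[C]_d) : \sum_b (p k b)%:C%C *: M = M.
Proof. by rewrite -scaler_suml -rmorph_sum p_sum1 scale1r. Qed.

(** Averaging with the swapped pair turns the left side into half of a difference of trace
    exponentials, to which [trexp_mean_value] applies. It is used with c = v k for the drift and
    with c = v k^2 / L for the squares. *)
Lemma exchange_mean_value k th (c : A -> 'M[C]_d) : 0 <= th ->
  (forall a, (c a)^t* = c a) ->
  mean2 k (fun x b => trexp th (c (x k) - c b) (total x)) <=
  th / 4 * mean2 k (fun x b => trexp th ((c (x k) - c b) *m (c (x k) - c b) +
    (v k (x k) - v k b) *m (v k (x k) - v k b)) (total x)).
Proof.
move=> th0 hc.
pose sq x b := (c (x k) - c b) *m (c (x k) - c b) +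
  (v k (x k) - v k b) *m (v k (x k) - v k b).
have sq_upd x b : sq (upd k x b) (x k) = sq x b.
  by rewrite /sq upd_at -[c b - _]opprB -[v k b - _]opprB mulmxN mulNmx
    opprK mulmxN mulNmx opprK.
(* Both sides are doubled so that one copy of each can be swapped: c (x k) - c b changes sign under
   the swap, while the sum of squares [sq] is invariant. *)
have half (g h : R) : g + g <= th / 4 * (h + h) -> g <= th / 4 * h by lra.
apply: half.
rewrite [X in X + _ <= _](_ : _ = mean2 k (fun x b =>
    - trexp th (c (x k) - c b) (total (upd k x b)))); last first.
  rewrite mean2_swap; apply: eq_mean2 => x b; rewrite upd_at.
  by rewrite -[c b - _]opprB trexpN.
rewrite [X in _ <= _ * (X + _)](_ : _ = mean2 k (fun x b =>
    trexp th (sq x b) (total (upd k x b)))); last first.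
  by rewrite mean2_swap; apply: eq_mean2 => x b; rewrite -sq_upd.
rewrite -!mean2D -mean2Z; apply: ler_mean2 => x b.
rewrite addrC [X in _ <= _ * X]addrC.
rewrite /sq -(total_upd k x b); apply: trexp_mean_value => //.
- exact: hermB.
- exact: total_herm.
- exact: total_herm.
Qed.

(** [mgf] is m(th); summed over k, [tsq] and [tvar] are the quantities S and V. *)
Definition mgf th := \sum_x weight x * trexp th 1%:M (total x).
Definition tsq th k := \sum_x weight x * trexp th (v k (x k) *m v k (x k)) (total x).
Definition tvar th k := \sum_x weight x * trexp th (var k) (total x).

(** Centering kills the two cross terms. *)
Lemma mean_sqB k a : \sum_b (p k b)%:C%C *: ((v k a - v k b) *m (v k a - v k b)) =
  v k a *m v k a + var k.
Proof.
transitivity (\sum_b ((p k b)%:C%C *: (v k a *m v k a)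
    - v k a *m ((p k b)%:C%C *: v k b) - ((p k b)%:C%C *: v k b) *m v k a
    + (p k b)%:C%C *: (v k b *m v k b))).
  apply: eq_bigr => b _; rewrite mulmxBr !mulmxBl -scalemxAl -scalemxAr.
  exact: scaler_expand.
rewrite !big_split /= !sumrN -mulmx_sumr -mulmx_suml v_centered mulmx0 mul0mx.
by rewrite !subr0 mean_const.
Qed.

(** Centering allows v k b to be subtracted at no cost; [exchange_mean_value] with c = v k then
    produces the same square twice, whence th / 2 in place of th / 4. *)
Lemma drift_term_le k th : 0 <= th ->
  \sum_x weight x * trexp th (v k (x k)) (total x) <=
  th / 2 * (tsq th k + tvar th k).
Proof.
move=> th0.
have E1 : \sum_x weight x * trexp th (v k (x k)) (total x) =
    mean2 k (fun x b => trexp th (v k (x k) - v k b) (total x)).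
  rewrite mean2_trexp; apply: eq_bigr => x _; congr (_ * trexp _ _ _).
  under eq_bigr do rewrite scalerBr.
  by rewrite sumrB v_centered subr0 mean_const.
rewrite E1; apply: le_trans (exchange_mean_value k th0 (v_herm k)) _.
rewrite mean2_trexp.
have -> : th / 2 * (tsq th k + tvar th k) =
    th / 4 * (\sum_x weight x * trexp th
       (2%:C%C *: (v k (x k) *m v k (x k) + var k)) (total x)).
  under eq_bigr do rewrite trexpZ trexpD mulrCA mulrDr.
  by rewrite -mulr_sumr big_split /= -/(tsq _ _) -/(tvar _ _); field.
rewrite le_eqVlt; apply/orP; left; apply/eqP; congr (_ * _).
apply: eq_bigr => x _; congr (_ * trexp _ _ _).
under eq_bigr do rewrite scalerDr.
by rewrite big_split /= mean_sqB rmorphD /= scalerDl scale1r.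
Qed.

(** [exchange_mean_value] with c = v k^2 / L: since v k^2 <= L^2, the square of c is at most v k^2,
    so both squared differences are controlled by the v k^2 themselves. *)
Lemma tsq_sub_le k th : 0 <= th ->
  tsq th k - tvar th k <= th * L * (tsq th k + tvar th k).
Proof.
move=> th0; move: L_ge0; rewrite le_eqVlt => /predU1P[L0|L_gt0].
  rewrite -L0 mulr0 mul0r subr_le0; apply: (@le_trans _ _ 0).
    apply: sumr_le0 => x _; rewrite mulr_ge0_le0 ?weight_ge0 //.
    rewrite -(trexp0 th (total x)) ler_trexp // => y.
    by have := v_bound k (x k) y; rewrite -L0 expr0n !qfB qf_scalar mul0r qf0.
  apply: sumr_ge0 => x _; rewrite mulr_ge0 ?weight_ge0 // trexp_ge0 // => y.
  by rewrite qf_sum sumr_ge0 // => a _; rewrite qfZ mulr_ge0 // psd_sq.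
pose c a : 'M[C]_d := (L^-1)%:C%C *: (v k a *m v k a).
have hc a : (c a)^t* = c a by rewrite hermZ // herm_sq.
have := exchange_mean_value k th0 hc.
have -> : mean2 k (fun x b => trexp th (c (x k) - c b) (total x)) =
    L^-1 * (tsq th k - tvar th k).
  rewrite mean2_trexp mulrBr /tsq /tvar !mulr_sumr -sumrB; apply: eq_bigr => x _.
  rewrite mulrCA [X in _ = _ - X]mulrCA -mulrBr -![L^-1 * _]trexpZ -trexpB.
  congr (_ * trexp _ _ _); under eq_bigr do rewrite scalerBr.
  rewrite sumrB mean_const; congr (_ - _); rewrite /var scaler_sumr.
  by apply: eq_bigr => a _; rewrite /c !scalerA mulrC.
move=> H; rewrite -(ler_pM2l (x := L^-1)) ?invr_gt0 //.
apply: (le_trans H).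
(* The 4 is twice the 2 of |x - y|^2 <= 2 |x|^2 + 2 |y|^2, which is applied to both squared
   differences. *)
have -> : L^-1 * (th * L * (tsq th k + tvar th k)) =
    th / 4 * mean2 k (fun x b => trexp th
      (4%:C%C *: (v k (x k) *m v k (x k) + v k b *m v k b)) (total x)).
  rewrite mean2_trexp.
  have -> : \sum_x weight x * trexp th (\sum_b (p k b)%:C%C *: (4%:C%C *:
      (v k (x k) *m v k (x k) + v k b *m v k b))) (total x) =
      4 * (tsq th k + tvar th k).
    rewrite /tsq /tvar -big_split mulr_sumr; apply: eq_bigr => x _ /=.
    rewrite -mulrDr [RHS]mulrCA -trexpD -[4 * _]trexpZ; congr (_ * trexp _ _ _).
    under eq_bigr do rewrite scalerA mulrC -scalerA scalerDr.
    by rewrite -scaler_sumr big_split /= mean_const.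
  by field; rewrite gt_eqF.
rewrite ler_wpM2l ?divr_ge0 //; apply: ler_mean2 => x b.
apply: ler_trexp => y; rewrite qfB qfZ !qfD !qf_sq //; try exact: hermB.
rewrite !mulmxBr.
have cle a : nrm2 (y *m c a) <= nrm2 (y *m v k a).
  rewrite /c -scalemxAr nrm2Z mulmxA.
  have := nrm2_le_of_psd (v_herm k a) (v_bound k a) (y *m v k a).
  move/(ler_wpM2l (sqr_ge0 L^-1)) => /le_trans; apply.
  by rewrite mulrA -exprMn mulVf ?gt_eqF // expr1n mul1r.
have comb (e f g h g' h' : R) : e <= 2 * g + 2 * h -> f <= 2 * g' + 2 * h' ->
    g <= g' -> h <= h' -> 0 <= 4 * (g' + h') - (e + f) by lra.
exact: comb (nrm2B_le _ _) (nrm2B_le _ _) (cle _) (cle _).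
Qed.

(** The sum on the left is the derivative of [mgf] at th, so this is the differential inequality for
    m. *)
Lemma mgf_drift_le th : 0 <= th -> th * L <= 1 ->
  (1 - th * L) * \sum_x weight x * trexp th (total x) (total x) <=
  th * s2 * mgf th.
Proof.
move=> th0 tL.
have -> : \sum_x weight x * trexp th (total x) (total x) =
    \sum_k \sum_x weight x * trexp th (v k (x k)) (total x).
  rewrite exchange_big; apply: eq_bigr => x _; rewrite {1}/total trexp_sum.
  by rewrite mulr_sumr.
have VE : \sum_k tvar th k <= s2 * mgf th.
  rewrite exchange_big /= mulr_sumr; apply: ler_sum => x _.
  rewrite -mulr_sumr -trexp_sum [leRHS]mulrCA -[s2 * _]trexpZ scalemx1.
  by rewrite ler_wpM2l ?weight_ge0 // ler_trexp.
have D := ler_sum (index_enum 'I_n) (fun k (_ : true) => drift_term_le k th0).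
have S := ler_sum (index_enum 'I_n) (fun k (_ : true) => tsq_sub_le k th0).
move: D S; rewrite sumrB -!mulr_sumr big_split /=.
set D := \sum_k _; set S := \sum_k tsq th k; set V := \sum_k tvar th k.
move: VE; rewrite -/V; set m := mgf th => VE DE SE.
have tL0 : 0 <= 1 - th * L by rewrite subr_ge0.
(* S - V <= th L (S + V) rearranges to (1 - th L) (S + V) <= 2 V, and V <= s2 m. *)
have h1 := ler_wpM2l tL0 DE.
have h2 : th / 2 * ((1 - th * L) * (S + V)) <= th / 2 * (2 * (s2 * m)).
  by rewrite ler_wpM2l ?divr_ge0 //; lra.
by apply: (le_trans h1); apply: le_trans _ (le_trans h2 _); lra.
Qed.

Theorem finite_mgf_le th : 0 <= th -> th * L < 1 ->
  mgf th <= d%:R * expR (th ^+ 2 * s2 / (2 * (1 - th * L))).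
Proof.
(* Freezing the denominator at the right endpoint th gives one constant K valid for every u < th. *)
move=> th0 tL; set K := s2 / (1 - th * L).
have den : 0 < 1 - th * L by rewrite subr_gt0.
(* [mgf] is a finite exponential sum over pairs of an outcome and an eigenvalue index, as
   [exp_sum_gronwall] requires. *)
have mgfE u : mgf u = \sum_(j : {ffun 'I_n -> A} * 'I_d)
    weight j.1 * expR (u * eig (total j.1) j.2).
  rewrite -(pair_bigA _ (fun x i => weight x * expR (u * eig (total x) i))) /=.
  by apply: eq_bigr => x _; rewrite trexp1 mulr_sumr.
have mgfE' u : \sum_x weight x * trexp u (total x) (total x) =
    \sum_(j : {ffun 'I_n -> A} * 'I_d) weight j.1 *
      (expR (u * eig (total j.1) j.2) * eig (total j.1) j.2).
  rewrite -(pair_bigA _ (fun x i => weight x *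
    (expR (u * eig (total x) i) * eig (total x) i))) /=.
  apply: eq_bigr => x _; rewrite trexp_self; last exact: total_herm.
  by rewrite mulr_sumr.
have m0 u : 0 <= mgf u.
  by rewrite mgfE sumr_ge0 // => j _; rewrite mulr_ge0 ?weight_ge0 ?expR_ge0.
rewrite mgfE.
apply: le_trans (@exp_sum_gronwall _ _ (fun j => weight j.1)
  (fun j => eig (total j.1) j.2) K th th0 _) _.
  move=> u /andP[u0 uth]; rewrite -mgfE' -mgfE.
  have utL : u * L <= th * L by rewrite ler_wpM2r // ltW.
  have uden : 0 < 1 - u * L by lra.
  rewrite -(ler_pM2l uden).
  apply: le_trans (mgf_drift_le (ltW u0) _) _; first by lra.
  have -> : (1 - u * L) * (K * u * mgf u) = (K * (1 - u * L)) * (u * mgf u).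
    by ring.
  have -> : u * s2 * mgf u = s2 * (u * mgf u) by ring.
  rewrite ler_wpM2r ?(mulr_ge0 (ltW u0)) //.
  rewrite /K mulrAC ler_pdivlMr //.
  by rewrite ler_wpM2l //; lra.
rewrite le_eqVlt; apply/orP; left; apply/eqP.
have -> : \sum_(j : {ffun 'I_n -> A} * 'I_d) weight j.1 = d%:R.
  rewrite -(pair_bigA _ (fun x (i : 'I_d) => weight x)) /=.
  under eq_bigr do rewrite sumr_const card_ord -mulr_natr.
  by rewrite -mulr_suml weight_sum1 mul1r.
rewrite mulrC; congr (_ * expR _); rewrite /K; field.
by rewrite gt_eqF.
Qed.

End FiniteModel.

(** * The largest eigenvalue *)

Section LambdaMax.
Variables (R : realType) (d : nat).
Hypothesis d_gt0 : (0 < d)%N.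
Local Notation C := R[i].
Implicit Types (x y : 'rV[C]_d) (M N H : 'M[C]_d).

Lemma eigenvalue_eig H i : H^t* = H -> eigenvalue H (eig H i)%:C%C.
Proof.
move=> hH; apply/eigenvalueP; exists (row i (spectralmx H)).
  exact: spectral_row.
apply/eqP => u0; have := nrm2_spectral_row H i; rewrite u0 /nrm2.
rewrite big1 => [/eqP|j _]; first by rewrite eq_sym oner_eq0.
by rewrite mxE /sqn /= expr0n addr0.
Qed.

Lemma qf_spectral H y : H^t* = H ->
  qf y H = \sum_i eig H i * sqn ((y *m (spectralmx H)^t*) 0 i).
Proof.
move=> hH; rewrite [in LHS](spectral_decomp hH).
rewrite -{2}[spectralmx H]trmxCK qf_congr.
set z := y *m _; rewrite /qf mul_mx_diag mxE Re_sum; apply: eq_bigr => i _.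
rewrite !mxE mulrAC mul_conj -rmorphM /= mulrC.
by [].
Qed.

Lemma qf_le_eig H i : H^t* = H -> (forall j, eig H j <= eig H i) ->
  forall y, qf y H <= eig H i * nrm2 y.
Proof.
move=> hH maxi y; rewrite qf_spectral //.
rewrite -(nrm2_unitary y (U := (spectralmx H)^t*)); last first.
  by rewrite trmxC_unitary spectral_unitarymx.
by rewrite mulr_sumr; apply: ler_sum => j _; rewrite ler_wpM2r ?sqn_ge0.
Qed.

Lemma qf_eigenvector H y (c : R) : y *m H = c%:C%C *: y -> qf y H = c * nrm2 y.
Proof.
by move=> yH; rewrite /qf yH -scalemxAl mxE mulmx_adj_nrm2 Re_mul /= mul0r subr0.
Qed.

(** The supremum is attained: the largest [eig] belongs to the set, and by the Rayleigh bound it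
    dominates every real eigenvalue. An index i exists because d > 0. *)
Lemma lambda_max_eig H : H^t* = H ->
  exists2 i, lambda_max H = eig H i & forall j, eig H j <= eig H i.
Proof.
move=> hH; pose i := [arg max_(i > Ordinal d_gt0) eig H i]%O.
have maxi j : eig H j <= eig H i.
  by rewrite /i; case: arg_maxP => // k _; apply.
exists i => //; rewrite /lambda_max.
have ubi : ubound [set x : R | eigenvalue H x%:C%C] (eig H i).
  move=> c /= /eigenvalueP[y yH y0].
  have y_gt0 : 0 < nrm2 y.
    rewrite lt_def nrm2_ge0 andbT; apply: contraNneq y0 => /nrm2_eq0 ->.
    by rewrite eqxx.
  by rewrite -(ler_pM2r y_gt0) -(qf_eigenvector yH) qf_le_eig.
have mi : [set x : R | eigenvalue H x%:C%C] (eig H i) by exact: eigenvalue_eig.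
apply/eqP; rewrite eq_le; apply/andP; split.
  by apply: ge_sup => //; exists (eig H i).
by apply: ub_le_sup => //; exists (eig H i).
Qed.

Lemma qf_le_lambda_max H y : H^t* = H -> qf y H <= lambda_max H * nrm2 y.
Proof.
by move=> hH; have [i -> maxi] := lambda_max_eig hH; exact: qf_le_eig.
Qed.

Lemma lambda_max_attained H : H^t* = H ->
  exists2 y, nrm2 y = 1 & qf y H = lambda_max H.
Proof.
move=> hH; have [i -> maxi] := lambda_max_eig hH.
exists (row i (spectralmx H)); first exact: nrm2_spectral_row.
by rewrite (qf_eigenvector (spectral_row i hH)) nrm2_spectral_row mulr1.
Qed.

(** The left side is one of the positive summands of the trace. *)
Lemma expR_lambda_max_le th H : H^t* = H ->
  expR (th * lambda_max H) <= trexp th 1%:M H.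
Proof.
move=> hH; have [i -> _] := lambda_max_eig hH.
rewrite trexp1 (bigD1 i) //= lerDl.
by apply: sumr_ge0 => j _; exact: expR_ge0.
Qed.

Lemma lambda_max_le H (c : R) : H^t* = H -> psd (c%:C%C%:M - H) ->
  lambda_max H <= c.
Proof.
move=> hH Hc; have [y y1 <-] := lambda_max_attained hH.
by have := Hc y; rewrite qfB qf_scalar y1 mulr1 subr_ge0.
Qed.

(** One half of Weyl's perturbation inequality, from Rayleigh quotients. *)
Lemma lambda_max_perturb H N (c : R) : H^t* = H -> N^t* = N ->
  psd (c%:C%C%:M - (H - N)) -> lambda_max H <= lambda_max N + c.
Proof.
move=> hH hN Hc; apply: lambda_max_le => // y; have := Hc y.
have := qf_le_lambda_max y hN.
by rewrite !qfB !qf_scalar mulrDl; lra.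
Qed.

Lemma spectral_norm_le_psd H (L : R) : H^t* = H -> 0 <= L ->
  spectral_norm H <= L -> psd ((L ^+ 2)%:C%C%:M - H *m H).
Proof.
move=> hH L0; rewrite /spectral_norm hH => HL y.
rewrite qfB qf_scalar subr_ge0.
apply: le_trans (qf_le_lambda_max y (herm_sq hH)) _.
rewrite ler_wpM2r ?nrm2_ge0 //.
(* [Num.sqrt] is 0 on negative arguments, so squaring it back needs this sign. *)
have l0 : 0 <= lambda_max (H *m H).
  have [z _ <-] := lambda_max_attained (herm_sq hH).
  exact: psd_sq.
by rewrite -(sqr_sqrtr l0) ler_pXn2r // nnegrE ?sqrtr_ge0.
Qed.

(** At a unit eigenvector for the top eigenvalue e, the form of H^2 is e^2; hence e^2 <=
    lambda_max(H^2) and e is at most the spectral norm. *)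
Lemma psd_spectral_norm H : H^t* = H ->
  psd ((spectral_norm H)%:C%C%:M - H).
Proof.
move=> hH y; rewrite qfB qf_scalar subr_ge0.
apply: le_trans (qf_le_lambda_max y hH) _; rewrite ler_wpM2r ?nrm2_ge0 //.
have [i -> _] := lambda_max_eig hH.
rewrite /spectral_norm hH; apply: (le_trans (ler_norm _)).
rewrite -sqrtr_sqr ler_wsqrtr //.
have := qf_le_lambda_max (row i (spectralmx H)) (herm_sq hH).
by rewrite nrm2_spectral_row mulr1 qf_sq // spectral_row // nrm2Z
  nrm2_spectral_row mulr1.
Qed.

End LambdaMax.

(** * Passing between entries and quadratic forms *)

Section EntrywiseBounds.
Variables (R : realType) (d : nat).
Local Notation C := R[i].
Implicit Types (z w : C) (x y : 'rV[C]_d) (M N H : 'M[C]_d).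

(** The Boolean lets one statement cover real and imaginary parts. *)
Definition part (b : bool) z : R := if b then complex.Re z else complex.Im z.

Lemma partD b z w : part b (z + w) = part b z + part b w.
Proof. by case: b; rewrite /= ?Re_add ?Im_add. Qed.

Lemma part_sum b (I : Type) (r : seq I) (Q : pred I) (F : I -> C) :
  part b (\sum_(i <- r | Q i) F i) = \sum_(i <- r | Q i) part b (F i).
Proof. by case: b; rewrite /= ?Re_sum ?Im_sum. Qed.

Lemma partN b z : part b (- z) = - part b z.
Proof. by case: b z => -[]. Qed.

Lemma qf_expand y M :
  qf y M = \sum_i \sum_j complex.Re (M i j * (y 0 i * Num.conj (y 0 j))).
Proof.
rewrite /qf mxE Re_sum exchange_big; apply: eq_bigr => j _ /=.
rewrite -Re_sum [X in X * _]mxE mulr_suml; congr complex.Re.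
by apply: eq_bigr => i _; rewrite !mxE mulrCA mulrA.
Qed.

(** A crude bound, 2 e |y|^2 for each of the d^2 terms; for the discretisation it only matters that
    it vanishes with e. *)
Lemma qf_entry_le M (e : R) y : 0 <= e -> (forall b i j, `|part b (M i j)| <= e) ->
  `|qf y M| <= 2 * e * d%:R ^+ 2 * nrm2 y.
Proof.
move=> e0 Me; rewrite qf_expand.
have -> : 2 * e * d%:R ^+ 2 * nrm2 y =
    \sum_(i < d) \sum_(j < d) (2 * e * nrm2 y).
  by rewrite !sumr_const !card_ord -mulrnA -[RHS]mulr_natr natrM; ring.
apply: le_trans (ler_norm_sum _ _ _) _; apply: ler_sum => i _.
apply: le_trans (ler_norm_sum _ _ _) _; apply: ler_sum => j _.
have le1 k : sqn (y 0 k) <= nrm2 y.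
  by rewrite /nrm2 (bigD1 k) //= lerDl sumr_ge0 // => l _; exact: sqn_ge0.
have hI := Re_mul_le (y 0 i) (Num.conj (y 0 j)).
have hR := Im_mul_le (y 0 i) (Num.conj (y 0 j)).
have e1 : sqn (Num.conj (y 0 j)) = sqn (y 0 j).
  by rewrite /sqn complex_Re_conj complex_Im_conj sqrrN.
move: hI hR; rewrite e1.
set z := _ * Num.conj _ => hI hR.
rewrite Re_mul; have := Me true i j; have := Me false i j => /= mI mR.
have n0 : 0 <= nrm2 y := nrm2_ge0 y.
have li := le1 i; have lj := le1 j.
have zR : `|complex.Re z| <= nrm2 y by apply: (le_trans hI); lra.
have zI : `|complex.Im z| <= nrm2 y by apply: (le_trans hR); lra.
apply: le_trans (ler_normB _ _) _; rewrite !normrM.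
have := ler_pM (normr_ge0 _) (normr_ge0 _) mR zR.
have := ler_pM (normr_ge0 _) (normr_ge0 _) mI zI.
by lra.
Qed.

Lemma psd_entry M (e : R) : 0 <= e -> (forall b i j, `|part b (M i j)| <= e) ->
  psd ((2 * e * d%:R ^+ 2)%:C%C%:M - M).
Proof.
move=> e0 Me y; rewrite qfB qf_scalar subr_ge0.
exact: le_trans (ler_norm _) (qf_entry_le y e0 Me).
Qed.

(** Row i of M is the image of the i-th basis vector, so its norm is at most L. *)
Lemma part_le_of_psd M (L : R) b i j : 0 <= L -> M^t* = M ->
  psd ((L ^+ 2)%:C%C%:M - M *m M) -> `|part b (M i j)| <= L.
Proof.
move=> L0 hM HL; have := nrm2_le_of_psd hM HL (delta_mx 0 i).
rewrite -rowE.
have -> : nrm2 (delta_mx 0 i : 'rV[C]_d) = 1.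
  rewrite /nrm2 (bigD1 i) //= big1 => [|k /negPf ki]; rewrite mxE ?eqxx /sqn /=.
    by rewrite addr0 expr1n expr0n addr0.
  by rewrite ki /= expr0n addr0.
rewrite mulr1 => H.
have sq : part b (M i j) ^+ 2 <= L ^+ 2.
  apply: le_trans H; apply: (@le_trans _ _ (sqn (M i j))).
    by rewrite /sqn; case: b; rewrite /= ?lerDl ?lerDr sqr_ge0.
  rewrite /nrm2 (bigD1 j) //= mxE lerDl sumr_ge0 // => l _; exact: sqn_ge0.
by rewrite -ler_sqr ?nnegrE // real_normK ?num_real.
Qed.

End EntrywiseBounds.

(** * Essentially bounded functions *)

Section BoundedMean.
Context {disp : measure_display} {Omega : measurableType disp} {R : realType}.
Variable P : probability Omega R.
Implicit Types (f g : Omega -> R) (S : set Omega).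

(** A class closed under sums and products on which [mean] is finite and linear, so that
    integrability is never checked separately. *)
Definition ess_bounded f :=
  measurable_fun setT f /\ exists M, {ae P, forall w, `|f w| <= M}.

Definition mean f : R := fine 'E_P[f]%E.

Lemma ess_bounded_integrable f : ess_bounded f -> P.-integrable setT (EFin \o f).
Proof.
move=> [mf [M fM]]; apply/integrableP; split; first exact/measurable_EFinP.
apply: (@le_lt_trans _ _ (\int[P]_w (`|M|)%:E)%E).
  apply: ae_ge0_le_integral => //.
  - by apply: measurableT_comp => //; exact/measurable_EFinP.
  - by apply: filterS fM => w fw _; rewrite lee_fin (le_trans fw) ?ler_norm.
by rewrite integral_cst //= probability_setT mule1 ltry.
Qed.

Lemma mean_fin f : ess_bounded f -> 'E_P[f]%E = (mean f)%:E.
Proof.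
move=> bf; rewrite /mean fineK // unlock.
exact: integrable_fin_num (ess_bounded_integrable bf).
Qed.

Lemma meanE f : mean f = \int[P]_w f w.
Proof. by rewrite /mean unlock. Qed.

Lemma ess_bounded_cst (c : R) : ess_bounded (cst c).
Proof. by split => //; exists `|c|; apply: aeW. Qed.

Lemma ess_boundedD f g : ess_bounded f -> ess_bounded g ->
  ess_bounded (fun w => f w + g w).
Proof.
move=> [mf [M fM]] [mg [N gN]]; split; first exact: measurable_funD.
exists (M + N); apply: filterS2 fM gN => w fw gw.
by apply: le_trans (ler_normD _ _) _; exact: lerD.
Qed.

Lemma ess_boundedM f g : ess_bounded f -> ess_bounded g ->
  ess_bounded (fun w => f w * g w).
Proof.
move=> [mf [M fM]] [mg [N gN]]; split; first exact: measurable_funM.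
exists (M * N); apply: filterS2 fM gN => w fw gw.
by rewrite normrM ler_pM.
Qed.

Lemma ess_boundedZ (c : R) f : ess_bounded f -> ess_bounded (fun w => c * f w).
Proof. by move=> bf; exact: ess_boundedM (ess_bounded_cst c) bf. Qed.

Lemma ess_boundedN f : ess_bounded f -> ess_bounded (fun w => - f w).
Proof.
by move=> bf; under eq_fun do rewrite -mulN1r; exact: ess_boundedZ.
Qed.

Lemma ess_bounded_sum (I : Type) (r : seq I) (F : I -> Omega -> R) :
  (forall i, ess_bounded (F i)) -> ess_bounded (fun w => \sum_(i <- r) F i w).
Proof.
move=> bF; elim: r => [|i r IH].
  by under eq_fun do rewrite big_nil; exact: ess_bounded_cst.
by under eq_fun do rewrite big_cons; exact: ess_boundedD.
Qed.

Lemma ess_bounded_indic S : measurable S -> ess_bounded (\1_S).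
Proof.
move=> mS; split; first exact: measurable_indic.
by exists 1; apply: aeW => w; rewrite indicE; case: (_ \in _);
  rewrite ?normr1 ?normr0.
Qed.

Lemma meanD f g : ess_bounded f -> ess_bounded g ->
  mean (fun w => f w + g w) = mean f + mean g.
Proof.
move=> bf bg; rewrite !meanE RintegralD //; exact: ess_bounded_integrable.
Qed.

Lemma meanZ (c : R) f : ess_bounded f -> mean (fun w => c * f w) = c * mean f.
Proof.
move=> bf; rewrite !meanE RintegralZl //; exact: ess_bounded_integrable.
Qed.

Lemma mean_cst (c : R) : mean (cst c) = c.
Proof. by rewrite /mean expectation_cst. Qed.

Lemma mean_indic S : measurable S -> mean (\1_S) = fine (P S).
Proof. by move=> mS; rewrite /mean expectation_indic. Qed.

Lemma mean_sum (I : Type) (r : seq I) (F : I -> Omega -> R) :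
  (forall i, ess_bounded (F i)) ->
  mean (fun w => \sum_(i <- r) F i w) = \sum_(i <- r) mean (F i).
Proof.
move=> bF; elim: r => [|i r IH].
  by under eq_fun do rewrite big_nil; rewrite big_nil; exact: mean_cst.
under eq_fun do rewrite big_cons.
by rewrite big_cons -IH meanD //; exact: ess_bounded_sum.
Qed.

Lemma mean_ge0 f : ess_bounded f -> {ae P, forall w, 0 <= f w} -> 0 <= mean f.
Proof.
move=> [mf _] f0; rewrite /mean unlock.
(* The absolute value makes the integrand nonnegative everywhere and not only almost everywhere. *)
have -> : (\int[P]_w (f w)%:E = \int[P]_w `|(f w)%:E|)%E.
  apply: ae_eq_integral => //.
  - exact/measurable_EFinP.
  - by apply: measurableT_comp => //; exact/measurable_EFinP.
  - by apply: filterS f0 => w fw _ /=; rewrite ger0_norm.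
by apply: fine_ge0; exact: integral_ge0.
Qed.

Lemma ler_mean f g : ess_bounded f -> ess_bounded g ->
  {ae P, forall w, f w <= g w} -> mean f <= mean g.
Proof.
move=> bf bg fg; rewrite -subr_ge0 -[X in _ - X]mul1r -mulNr -meanZ //.
rewrite -meanD //; last exact: ess_boundedZ.
apply: mean_ge0; first by apply: ess_boundedD => //; exact: ess_boundedZ.
by apply: filterS fg => w fw; rewrite mulN1r subr_ge0.
Qed.

(** Cauchy-Schwarz against the indicator. It is Jensen's inequality for the conditional mean on S,
    freed of the division by P(S) so that null events are included. *)
Lemma mean_indic_sqr_le S f : measurable S -> ess_bounded f ->
  mean (fun w => \1_S w * f w) ^+ 2 <=
  mean (\1_S) * mean (fun w => \1_S w * f w ^+ 2).
Proof.
move=> mS bf; have bS := ess_bounded_indic mS.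
(* The discriminant of the nonnegative form mean (\1_S * (s f - t)^2). *)
set e := mean (fun w => \1_S w * f w); set q := mean (fun w => _ * _ ^+ 2).
set p := mean (\1_S).
have bSf : ess_bounded (fun w => \1_S w * f w) by exact: ess_boundedM.
have bSff : ess_bounded (fun w => \1_S w * f w ^+ 2).
  by apply: ess_boundedM => //; exact: ess_boundedM.
have disc (s t : R) : 0 <= s ^+ 2 * q + (- (2 * s * t) * e + t ^+ 2 * p).
  rewrite -!meanZ // -!meanD //; try by [exact: ess_boundedZ |
    apply: ess_boundedD; exact: ess_boundedZ].
  apply: mean_ge0.
    by apply: ess_boundedD; [|apply: ess_boundedD]; exact: ess_boundedZ.
  apply: aeW => w /=.
  have -> : s ^+ 2 * (\1_S w * f w ^+ 2) +
      (- (2 * s * t) * (\1_S w * f w) + t ^+ 2 * \1_S w) =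
      \1_S w * (s * f w - t) ^+ 2 by ring.
  by rewrite mulr_ge0 ?sqr_ge0 // indicE.
have p0 : 0 <= p by apply: mean_ge0 => //; apply: aeW => w; rewrite indicE.
have [p_gt0|p_le0] := ltP 0 p.
  rewrite -subr_ge0 -(pmulr_rge0 _ p_gt0).
  have -> : p * (p * q - e ^+ 2) = p ^+ 2 * q + (- (2 * p * e) * e + e ^+ 2 * p).
    by ring.
  exact: disc.
have pe : p = 0 by apply/eqP; rewrite eq_le p_le0.
have [e0|e0] := eqVneq e 0; first by rewrite e0 pe expr0n mul0r.
(* For p = 0 the form is affine in t, and this t gives it the value -1. *)
have := disc 1 ((q + 1) / (2 * e)).
have -> : 1 ^+ 2 * q + (- (2 * 1 * ((q + 1) / (2 * e))) * e +
    ((q + 1) / (2 * e)) ^+ 2 * p) = -1 by rewrite pe; field.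
by lra.
Qed.

End BoundedMean.

(** * Complex means and grid cells *)

Section ComplexMean.
Context {disp : measure_display} {Omega : measurableType disp} {R : realType}.
Variable P : probability Omega R.
Local Notation C := R[i].
Implicit Types (F G : Omega -> C) (S : set Omega).

Definition cess_bounded F := forall b, ess_bounded P (fun w => part b (F w)).

(** The entries of [expectation_mx] unfold to [cmean], so the two are interchangeable by
    conversion. *)
Definition cmean F : C :=
  (mean P (fun w => complex.Re (F w)) +i* mean P (fun w => complex.Im (F w)))%C.

Lemma cess_boundedM F G : cess_bounded F -> cess_bounded G ->
  cess_bounded (fun w => F w * G w).
Proof.
move=> bF bG [] /=.
  under eq_fun do rewrite Re_mul.
  apply: ess_boundedD; last apply: ess_boundedN; apply: ess_boundedM;
  by [exact: (bF true)|exact: (bG true)|exact: (bF false)|exact: (bG false)].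
under eq_fun do rewrite Im_mul.
apply: ess_boundedD; apply: ess_boundedM;
  by [exact: (bF true)|exact: (bG true)|exact: (bF false)|exact: (bG false)].
Qed.

Lemma cess_bounded_cst (c : C) : cess_bounded (cst c).
Proof. by move=> b; exact: (ess_bounded_cst P (part b c)). Qed.

Lemma cess_bounded_sum (I : Type) (r : seq I) (F : I -> Omega -> C) :
  (forall i, cess_bounded (F i)) -> cess_bounded (fun w => \sum_(i <- r) F i w).
Proof.
move=> bF b; under eq_fun do rewrite part_sum.
by apply: ess_bounded_sum => i; exact: bF.
Qed.

Lemma cess_bounded_indic S : measurable S -> cess_bounded (fun w => (\1_S w)%:C%C).
Proof.
move=> mS [] /=; last exact: (ess_bounded_cst P 0).
exact: ess_bounded_indic.
Qed.

Lemma cmeanZ (c : C) F : cess_bounded F -> cmean (fun w => c * F w) = c * cmean F.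
Proof.
move=> bF; have bT := bF true; have bI := bF false; rewrite /= in bT bI.
apply: complexP; rewrite ?(Re_mul, Im_mul) /=.
  under eq_fun do rewrite Re_mul -mulNr.
  by rewrite meanD ?meanZ ?mulNr //; exact: ess_boundedZ.
under eq_fun do rewrite Im_mul.
by rewrite meanD ?meanZ //; exact: ess_boundedZ.
Qed.

Lemma cmean_conj F : cess_bounded F ->
  cmean (fun w => Num.conj (F w)) = Num.conj (cmean F).
Proof.
move=> bF; apply: complexP; rewrite ?complex_Re_conj ?complex_Im_conj /cmean /=.
  by under eq_fun do rewrite complex_Re_conj.
under eq_fun do rewrite complex_Im_conj -mulN1r.
by rewrite meanZ ?mulN1r //; exact: (bF false).
Qed.

Lemma cmean_sum (I : Type) (r : seq I) (F : I -> Omega -> C) :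
  (forall i, cess_bounded (F i)) ->
  cmean (fun w => \sum_(i <- r) F i w) = \sum_(i <- r) cmean (F i).
Proof.
move=> bF; apply: complexP; rewrite ?(Re_sum, Im_sum) /=.
  under eq_fun do rewrite Re_sum.
  by apply: mean_sum => i; exact: (bF i true).
under eq_fun do rewrite Im_sum.
by apply: mean_sum => i; exact: (bF i false).
Qed.

Lemma ess_bounded_sqn F : cess_bounded F -> ess_bounded P (fun w => sqn (F w)).
Proof.
move=> bF; apply: ess_boundedD; apply: ess_boundedM;
  by [exact: (bF true)|exact: (bF false)].
Qed.

Lemma sqn_cmean_indic_le S F : measurable S -> cess_bounded F ->
  sqn (cmean (fun w => (\1_S w)%:C%C * F w)) <=
  mean P (\1_S) * mean P (fun w => \1_S w * sqn (F w)).
Proof.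
move=> mS bF; rewrite /sqn /=.
have -> : (fun w => complex.Re ((\1_S w)%:C%C * F w)) =
    (fun w => \1_S w * complex.Re (F w)).
  by apply/funext => w; rewrite Re_mul /= mul0r subr0.
have -> : (fun w => complex.Im ((\1_S w)%:C%C * F w)) =
    (fun w => \1_S w * complex.Im (F w)).
  by apply/funext => w; rewrite Im_mul /= mul0r addr0.
have bS := ess_bounded_indic P mS.
under [X in _ <= _ * mean _ X]eq_fun do rewrite mulrDr.
rewrite meanD; [| |]; try by
  apply: ess_boundedM => //; apply: ess_boundedM;
  [exact: (bF true)|exact: (bF true)] ||
  (apply: ess_boundedM => //; apply: ess_boundedM;
  [exact: (bF false)|exact: (bF false)]).
by rewrite mulrDr; apply: lerD; apply: mean_indic_sqr_le => //;
  [exact: (bF true)|exact: (bF false)].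
Qed.

End ComplexMean.

(** * Grid cells in the space of matrices *)

Section Cells.
Variables (R : realType) (d : nat).
Local Notation C := R[i].
Implicit Types (M : 'M[C]_d) (N : nat).

Local Notation tests N := ('I_d * 'I_d * bool * 'I_(2 * N.+1 ^ 2).+1)%type.

(** Steps of 1/(N+1) starting at -(N+1); the last index 2 (N+1)^2 gives exactly N+1. *)
Definition threshold N (j : nat) : R := j%:R / N.+1%:R - N.+1%:R.

(* The cell of M in the grid of mesh 1/(N+1) covering entries in [-(N+1), N+1],
   encoded by the outcomes of all threshold tests on real and imaginary parts. *)
Definition cell N M : {ffun tests N -> bool} :=
  [ffun q : tests N => threshold N q.2 <= part q.1.2 (M q.1.1.1 q.1.1.2)].

Lemma threshold_close N (r s : R) : `|r| < N.+1%:R ->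
  (forall j : 'I_(2 * N.+1 ^ 2).+1, (threshold N j <= r) = (threshold N j <= s)) ->
  `|s - r| <= N.+1%:R^-1.
Proof.
set n : R := N.+1%:R => rn H.
have n0 : 0 < n by rewrite ltr0n.
have : 0 <= (r + n) * n.
  by rewrite mulr_ge0 ?ltW //; move: rn; rewrite ltr_norml; lra.
move=> /truncn_itv; set j := Num.truncn _ => /andP[j1 j2].
(* The strict bound on r makes j + 1 a legal index, so r lies between two consecutive thresholds,
   and s passes the same two tests. *)
have jle : (j.+1 < (2 * N.+1 ^ 2).+1)%N.
  rewrite ltnS -(ltr_nat R) natrM natrX -/n; apply: le_lt_trans j1 _.
  have : r + n < 2 * n by move: rn; rewrite ltr_norml; lra.
  by rewrite -(ltr_pM2r n0) -mulrA -expr2.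
have h1 := H (Ordinal (ltnW jle)); have h2 := H (Ordinal jle).
move: h1 h2; rewrite /threshold /= -/n.
have -> : j%:R / n - n <= r by rewrite lerBlDr ler_pdivrMr.
have -> : (j.+1%:R / n - n <= r) = false.
  by apply/negbTE; rewrite -ltNge ltrBrDr ltr_pdivlMr.
move=> /esym s1 /esym/negbT; rewrite -ltNge => s2.
have r1 : j%:R / n - n <= r by rewrite lerBlDr ler_pdivrMr.
have r2 : r < j.+1%:R / n - n by rewrite ltrBrDr ltr_pdivlMr.
move: s2 r2; rewrite -natr1 mulrDl mul1r.
by rewrite ler_norml; set e := n^-1; set t := _ * e; move: s1 r1; rewrite -/t; lra.
Qed.

Lemma cell_close N M M' b i j : cell N M = cell N M' ->
  `|part b (M i j)| < N.+1%:R ->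
  `|part b (M' i j) - part b (M i j)| <= N.+1%:R^-1.
Proof.
move=> MM' Mlt; apply: threshold_close => // k.
have := congr1 (fun f : {ffun tests N -> bool} => f (i, j, b, k)) MM'.
by rewrite !ffunE.
Qed.

Lemma measurable_part b i j :
  measurable_fun setT (fun M : 'M[C]_d => part b (M i j)).
Proof.
move=> _ A mA; rewrite setTI; apply: sub_sigma_algebra.
by exists i, j, A; split => //; case: b; [left|right].
Qed.

Lemma measurable_cell N (a : {ffun tests N -> bool}) :
  measurable ([set M | cell N M = a] : set 'M[C]_d).
Proof.
have -> : [set M | cell N M = a] = \big[setI/setT]_(q : tests N)
    [set M : 'M[C]_d | (threshold N q.2 <= part q.1.2 (M q.1.1.1 q.1.1.2)) = a q].
  rewrite -bigcap_seq; apply/seteqP; split => M /=.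
    by move=> <- q _ /=; rewrite ffunE.
  by move=> H; apply/ffunP => q; rewrite ffunE; apply: H => /=; rewrite mem_index_enum.
apply: bigsetI_measurable => q _.
have mp := @measurable_part q.1.2 q.1.1.1 q.1.1.2.
case: (a q).
  have := mp measurableT `[threshold N q.2, +oo[%classic (measurable_itv _).
  rewrite setTI; congr measurable; apply/seteqP; split => M /=;
    by rewrite in_itv /= andbT.
have := mp measurableT `]-oo, threshold N q.2[%classic (measurable_itv _).
rewrite setTI; congr measurable; apply/seteqP; split => M /=;
  rewrite in_itv /= ltNge; first by move/negbTE.
by move=> ->.
Qed.

End Cells.

(** * Conditional means *)

Section ConditionalMean.
Context {disp : measure_display} {Omega : measurableType disp} {R : realType}.
Variables (P : probability Omega R) (d : nat).
Local Notation C := R[i].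
Variables (S : set Omega) (Y : Omega -> 'M[C]_d).
Hypothesis mS : measurable S.
Hypothesis Y_bounded : forall i j, cess_bounded P (fun w => Y w i j).

(* The junk value of a null event is 0, since 0^-1 = 0. *)
Definition cond_mean : 'M[C]_d := \matrix_(i, j)
  (((mean P (\1_S))^-1)%:C%C * cmean P (fun w => (\1_S w)%:C%C * Y w i j)).

Let bS : ess_bounded P (\1_S : Omega -> R) := ess_bounded_indic P mS.
Let bcS : cess_bounded P (fun w => (\1_S w)%:C%C) := cess_bounded_indic P mS.

Let p_ge0 : 0 <= mean P (\1_S : Omega -> R).
Proof. by apply: mean_ge0 => //; apply: aeW => w; rewrite indicE. Qed.

Lemma cond_mean_herm : (forall w, (Y w)^t* = Y w) -> cond_mean^t* = cond_mean.
Proof.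
move=> hY; apply/matrixP => i j; rewrite !mxE rmorphM /=.
have cr (c : R) : Num.conj (c%:C%C : C) = c%:C%C.
  by apply: complexP => //=; rewrite oppr0.
rewrite -cmean_conj; last exact: cess_boundedM.
rewrite cr; congr (_ * _); congr cmean.
by apply/funext => w; rewrite rmorphM /= -{2}hY !mxE cr.
Qed.

Lemma cmean_indic_null F : cess_bounded P F -> mean P (\1_S : Omega -> R) = 0 ->
  cmean P (fun w => (\1_S w)%:C%C * F w) = 0.
Proof.
move=> bF p0; have := sqn_cmean_indic_le mS bF; rewrite p0 mul0r.
set z := cmean _ _ => h.
have /eqP : sqn z = 0 by apply/eqP; rewrite eq_le h sqn_ge0.
rewrite /sqn paddr_eq0 ?sqr_ge0 // !sqrf_eq0 => /andP[/eqP h1 /eqP h2].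
exact: complexP.
Qed.

(** True for null S as well: both sides are then 0, the right one by [cmean_indic_null]. *)
Lemma scale_cond_mean : (mean P (\1_S : Omega -> R))%:C%C *: cond_mean =
  \matrix_(i, j) cmean P (fun w => (\1_S w)%:C%C * Y w i j).
Proof.
apply/matrixP => i j; rewrite !mxE.
have [p0|p0] := eqVneq (mean P (\1_S : Omega -> R)) 0.
  by rewrite cmean_indic_null // mulr0 mulr0.
by rewrite mulrA -rmorphM /= mulfV // mul1r.
Qed.

(** Jensen's inequality for the squared norm, coordinate by coordinate. *)
Lemma nrm2_cond_mean_le (x : 'rV[C]_d) :
  mean P (\1_S : Omega -> R) * nrm2 (x *m cond_mean) <=
  mean P (fun w => \1_S w * nrm2 (x *m Y w)).
Proof.
have bxY j : cess_bounded P (fun w => (x *m Y w) 0 j).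
  under eq_fun do rewrite mxE; apply: cess_bounded_sum => i.
  exact: cess_boundedM (cess_bounded_cst _ _) (Y_bounded i j).
have -> : (fun w => \1_S w * nrm2 (x *m Y w)) =
    (fun w => \sum_j \1_S w * sqn ((x *m Y w) 0 j)).
  by apply/funext => w; rewrite mulr_sumr.
rewrite mean_sum; last by move=> j; apply: ess_boundedM => //; exact: ess_bounded_sqn.
rewrite mulr_sumr; apply: ler_sum => j _.
have -> : (x *m cond_mean) 0 j = ((mean P (\1_S))^-1)%:C%C *
    cmean P (fun w => (\1_S w)%:C%C * (x *m Y w) 0 j).
  have -> : (fun w => (\1_S w)%:C%C * (x *m Y w) 0 j) =
      (fun w => \sum_i x 0 i * ((\1_S w)%:C%C * Y w i j)).
    by apply/funext => w; rewrite mxE mulr_sumr; apply: eq_bigr => i _; rewrite mulrCA.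
  rewrite cmean_sum; last first.
    move=> i; apply: cess_boundedM (cess_bounded_cst _ _) _.
    exact: cess_boundedM.
  rewrite mxE mulr_sumr; apply: eq_bigr => i _.
  rewrite mxE [X in _ = _ * X]cmeanZ; last exact: cess_boundedM.
  exact: mulrCA.
have := sqn_cmean_indic_le mS (bxY j).
rewrite sqnM sqn_real; move: p_ge0; set p := mean P (\1_S).
set q := mean P _; rewrite le_eqVlt => /predU1P[<- _|p_gt0 h].
  rewrite mul0r; apply: mean_ge0.
    by apply: ess_boundedM => //; exact: ess_bounded_sqn.
  by apply: aeW => w; rewrite mulr_ge0 ?sqn_ge0 // indicE.
rewrite mulrA expr2 mulrA mulfV ?gt_eqF // mul1r.
by rewrite mulrC ler_pdivrMr // mulrC.
Qed.

Lemma cond_mean_close b i j (r e : R) : 0 < mean P (\1_S : Omega -> R) ->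
  (forall w, S w -> `|part b (Y w i j) - r| <= e) ->
  `|part b (cond_mean i j) - r| <= e.
Proof.
set p := mean P _ => p_gt0 H; rewrite mxE -/p.
have -> : part b ((p^-1)%:C%C * cmean P (fun w => (\1_S w)%:C%C * Y w i j)) =
    p^-1 * mean P (fun w => \1_S w * part b (Y w i j)).
  have -> : (fun w => \1_S w * part b (Y w i j)) =
      (fun w => part b ((\1_S w)%:C%C * Y w i j)).
    by apply/funext => w; case: b {H};
      rewrite /= ?Re_mul ?Im_mul /= mul0r ?subr0 ?addr0.
  by case: b {H}; rewrite /= ?Re_mul ?Im_mul /= mul0r ?subr0 ?addr0.
have bf := Y_bounded i j b.
have bSf : ess_bounded P (fun w => \1_S w * part b (Y w i j)) by exact: ess_boundedM.
have up : mean P (fun w => \1_S w * part b (Y w i j)) <= (r + e) * p.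
  rewrite /p -meanZ //; apply: ler_mean => //; first exact: ess_boundedZ.
  apply: aeW => w; rewrite indicE; case: (boolP (w \in S)) => [/set_mem/H|_].
    by rewrite ler_norml /= mul1r mulr1; lra.
  by rewrite mul0r mulr0.
have lo : (r - e) * p <= mean P (fun w => \1_S w * part b (Y w i j)).
  rewrite /p -meanZ //; apply: ler_mean => //; first exact: ess_boundedZ.
  apply: aeW => w; rewrite indicE; case: (boolP (w \in S)) => [/set_mem/H|_].
    by rewrite ler_norml /= mul1r mulr1; lra.
  by rewrite mul0r mulr0.
rewrite ler_norml lerBrDr lerBlDr mulrC ler_pdivrMr // ler_pdivlMr //.
by rewrite addrC lo addrC up.
Qed.

End ConditionalMean.

(** * Discretisation of independent random matrices *)

Lemma ae_forall_ord (disp : measure_display) (T : measurableType disp)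
    (R : realType) (mu : {measure set T -> \bar R}) (n : nat)
    (Q : 'I_n -> T -> Prop) :
  (forall k, {ae mu, forall w, Q k w}) -> {ae mu, forall w, forall k, Q k w}.
Proof.
(* [ae_foralln] quantifies over [nat], so indices are compared through their values. *)
move=> H; have : {ae mu, forall w, forall m : nat, forall k : 'I_n,
    k = m :> nat -> Q k w}.
  apply: ae_foralln => m; have [mn|nm] := ltnP m n.
    apply: filterS (H (Ordinal mn)) => w Qw k km.
    by have -> : k = Ordinal mn by exact: val_inj.
  by apply: aeW => w k km; move: (ltn_ord k); rewrite km ltnNge nm.
by apply: filterS => w Qw k; exact: Qw.
Qed.

Lemma sum_indic_fiber (R : realType) (T : Type) (F : finType) (g : T -> F)
    (h : F -> R) w : \sum_a \1_[set w | g w = a] w * h a = h (g w).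
Proof.
rewrite (bigD1 (g w)) //= big1 ?addr0 => [|a /eqP ga].
  by rewrite indicE mem_set ?mul1r.
by rewrite indicE memNset ?mul0r // => /esym.
Qed.

(** Removes the discretisation error in the limit. If a > K, then e = ln(a / K) / 2 gives a / K <=
    exp(e), although ln(a / K) > e. *)
Lemma ler_of_expR_factor (R : realType) (a K : R) : 0 < K ->
  (forall e, 0 < e -> a <= expR e * K) -> a <= K.
Proof.
move=> K0 H; rewrite leNgt; apply/negP => Ka.
have aK : 1 < a / K by rewrite ltr_pdivlMr // mul1r.
have l0 : 0 < ln (a / K) by rewrite ln_gt0.
have /H : 0 < ln (a / K) / 2 by rewrite divr_gt0.
rewrite -ler_pdivrMr // leNgt => /negP; apply.
rewrite -{2}[a / K]lnK ?posrE ?(lt_trans _ aK) // ltr_expR.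
by lra.
Qed.

Section SumsOfMatrices.
Variables (R : realType) (d n : nat).
Local Notation C := R[i].

Lemma sum_entries_close (A B : 'I_n -> 'M[C]_d) (e : R) :
  (forall k b i j, `|part b (A k i j) - part b (B k i j)| <= e) ->
  forall b i j, `|part b ((\sum_k A k - \sum_k B k) i j)| <= n%:R * e.
Proof.
move=> H b i j; rewrite -sumrB summxE part_sum.
apply: le_trans (ler_norm_sum _ _ _) _.
have -> : n%:R * e = \sum_(k < n) e by rewrite sumr_const card_ord mulr_natl.
by apply: ler_sum => k _; rewrite !mxE partD partN.
Qed.

Lemma lambda_max_sum_le (A B : 'I_n -> 'M[C]_d) (e : R) : (0 < d)%N -> 0 <= e ->
  (forall k, (A k)^t* = A k) -> (forall k, (B k)^t* = B k) ->
  (forall k b i j, `|part b (A k i j) - part b (B k i j)| <= e) ->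
  lambda_max (\sum_k A k) <=
    lambda_max (\sum_k B k) + 2 * (n%:R * e) * d%:R ^+ 2.
Proof.
move=> d0 e0 hA hB H; apply: lambda_max_perturb => //; try exact: herm_sum.
by apply: psd_entry; [rewrite mulr_ge0|exact: sum_entries_close].
Qed.

Lemma lambda_max_sum_bound (A : 'I_n -> 'M[C]_d) (L : R) : (0 < d)%N -> 0 <= L ->
  (forall k, (A k)^t* = A k) -> (forall k b i j, `|part b (A k i j)| <= L) ->
  `|lambda_max (\sum_k A k)| <= 2 * (n%:R * L) * d%:R ^+ 2.
Proof.
move=> d0 L0 hA H.
have hS : (\sum_k A k)^t* = \sum_k A k by exact: herm_sum.
have [y y1 <-] := lambda_max_attained d0 hS.
have nL : 0 <= n%:R * L by rewrite mulr_ge0.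
have HS b i j : `|part b ((\sum_k A k) i j)| <= n%:R * L.
  have := @sum_entries_close A (fun=> 0) L; rewrite sumr_const mul0rn subr0; apply.
  by move=> k {}b {}i {}j; rewrite mxE; case: b (H k b i j) => /=; rewrite subr0.
by have := qf_entry_le y nL HS; rewrite y1 mulr1.
Qed.

End SumsOfMatrices.

(** * From grid cells to the random matrices *)

Section MatrixMgf.
Context {R : realType} {disp : measure_display} {Omega : measurableType disp}.
Variables (P : probability Omega R) (d : nat).
Hypothesis d_gt0 : (0 < d)%N.
Variables (n : nat) (Y : 'I_n -> {RV P >-> 'M[R[i]]_d}).
Local Notation C := R[i].
Hypothesis Y_herm : forall k w, (Y k w)^t* = Y k w.

Lemma measurable_part_RV k b i j :
  measurable_fun setT (fun w => part b (Y k w i j)).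
Proof.
exact: (measurableT_comp (@measurable_part R d b i j) (measurable_funPT (Y k))).
Qed.

Definition cells N w := [ffun k => cell N (Y k w)].

Lemma measurable_cell_event N k a : measurable [set w | cell N (Y k w) = a].
Proof.
have := measurable_funPT (Y k) measurableT _ (measurable_cell a).
by rewrite setTI.
Qed.

Lemma cells_eventE N x : [set w | cells N w = x] =
  \bigcap_(k in [set` [set: 'I_n]%SET]) (Y k @^-1` [set M | cell N M = x k]).
Proof.
apply/seteqP; split => w /=; first by move=> <- k _ /=; rewrite ffunE.
by move=> H; apply/ffunP => k; rewrite ffunE; apply: H => /=; rewrite inE.
Qed.

Lemma measurable_cells_event N x : measurable [set w | cells N w = x].
Proof.
rewrite cells_eventE; apply: fin_bigcap_measurable; first exact: finite_finset.
by move=> k _; exact: measurable_cell_event.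
Qed.

(** A Hermitian point of the cell, or 0 if there is none. Being close to [Y k w] at every w, it
    serves to prove measurability. *)
Definition representative N a : 'M[C]_d :=
  xget 0 [set M : 'M[C]_d | M^t* = M /\ cell N M = a].

Lemma representativeP N (M : 'M[C]_d) : M^t* = M ->
  (representative (cell N M))^t* = representative (cell N M) /\
  cell N (representative (cell N M)) = cell N M.
Proof.
move=> hM; rewrite /representative.
by case: xgetP => [M' _ //|/(_ M) []].
Qed.

(** A pointwise limit of functions that depend on the cells only, hence take finitely many
    values. *)
Lemma measurable_lambda_max_sum :
  measurable_fun setT (fun w => lambda_max (\sum_k Y k w)).
Proof.
pose g N w := lambda_max (\sum_k representative (cell N (Y k w))).
apply: (@measurable_fun_cvg _ _ _ _ g) => [N|w _].
  have -> : g N = fun w => \sum_x \1_[set w | cells N w = x] w *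
      lambda_max (\sum_k representative (x k)).
    apply/funext => w.
    rewrite (sum_indic_fiber (cells N)
      (fun x : {ffun 'I_n -> _} => lambda_max (\sum_k representative (x k)))).
    by rewrite /g; congr lambda_max; apply: eq_bigr => k _; rewrite ffunE.
  apply: measurable_sum => x; apply: measurable_funM => //.
  by apply: measurable_indic; exact: measurable_cells_event.
(* B depends on w, which is enough for pointwise convergence: the entries at w are inside the grid
   once N + 1 > B. *)
pose B := \sum_(q : 'I_n * 'I_d * 'I_d * bool)
  `|part q.2 (Y q.1.1.1 w q.1.1.2 q.1.2)|.
have HB k b i j : `|part b (Y k w i j)| <= B.
  by rewrite /B (bigD1 (k, i, j, b)) //= lerDl sumr_ge0.
pose D : R := 2 * n%:R * d%:R ^+ 2.
apply/cvgrPdist_le => e e0; near=> N.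
have NB : B < N.+1%:R.
  rewrite -natr1; apply: (@le_lt_trans _ _ N%:R); last by rewrite ltrDl.
  by near: N; exact: nbhs_infty_ger.
have ND : D / e <= N.+1%:R.
  rewrite -natr1; apply: (@le_trans _ _ N%:R); last by rewrite lerDl.
  by near: N; exact: nbhs_infty_ger.
have De : 2 * (n%:R * N.+1%:R^-1) * d%:R ^+ 2 <= e.
  have -> : 2 * (n%:R * N.+1%:R^-1) * d%:R ^+ 2 = D / N.+1%:R.
    by rewrite /D; ring.
  by rewrite ler_pdivrMr ?ltr0n // mulrC -ler_pdivrMr.
have i0 : (0 : R) <= N.+1%:R^-1 by rewrite invr_ge0.
have cl k b i j : `|part b (representative (cell N (Y k w)) i j) -
    part b (Y k w i j)| <= N.+1%:R^-1.
  apply: cell_close; first by have [_ ->] := representativeP N (Y_herm k w).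
  exact: le_lt_trans (HB _ _ _ _) NB.
have hr k : (representative (cell N (Y k w)))^t* = representative (cell N (Y k w)).
  by have [] := representativeP N (Y_herm k w).
have u1 : g N w <= lambda_max (\sum_k Y k w) + e.
  apply: le_trans (lerD (lexx _) De).
  exact: (lambda_max_sum_le d_gt0 i0 hr (fun k => Y_herm k w) cl).
have u2 : lambda_max (\sum_k Y k w) <= g N w + e.
  apply: le_trans (lerD (lexx _) De).
  apply: (lambda_max_sum_le d_gt0 i0 (fun k => Y_herm k w) hr) => k b i j.
  by rewrite distrC.
move: u1 u2; move: (g N w) (lambda_max _) => a b u1 u2.
by rewrite ler_distl lerBlDr u1 u2.
Unshelve. all: by end_near.
Qed.

Variables (L : R).
Hypothesis L_ge0 : 0 <= L.
Hypothesis Y_bounded :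
  forall k, {ae P, forall w, psd ((L ^+ 2)%:C%C%:M - Y k w *m Y k w)}.

Let Y_good : {ae P, forall w, forall k, psd ((L ^+ 2)%:C%C%:M - Y k w *m Y k w)}.
Proof. exact: ae_forall_ord. Qed.

Lemma cess_bounded_entry k i j : cess_bounded P (fun w => Y k w i j).
Proof.
move=> b; split; first exact: measurable_part_RV.
by exists L; apply: filterS (Y_bounded k) => w; exact: part_le_of_psd.
Qed.

Lemma ess_bounded_lambda_max_sum :
  ess_bounded P (fun w => lambda_max (\sum_k Y k w)).
Proof.
split; first exact: measurable_lambda_max_sum.
exists (2 * (n%:R * L) * d%:R ^+ 2); apply: filterS Y_good => w HY.
by apply: lambda_max_sum_bound => // k b i j; exact: part_le_of_psd.
Qed.

Lemma ess_bounded_expR (f : Omega -> R) :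
  ess_bounded P f -> ess_bounded P (fun w => expR (f w)).
Proof.
move=> [mf [M fM]]; split; first exact: measurableT_comp.
exists (expR M); apply: filterS fM => w fw.
by rewrite ger0_norm ?expR_ge0 // ler_expR (le_trans (ler_norm _)).
Qed.

(** With [cell_mean] as values, these are the probabilities of the discretised Y_k, that is, the p
    and v of the finite model. *)
Definition cell_prob N k a : R := mean P (\1_[set w | cell N (Y k w) = a]).
Definition cell_mean N k a : 'M[C]_d :=
  cond_mean P [set w | cell N (Y k w) = a] (Y k).

Arguments cell_prob : clear implicits.
Arguments cell_mean : clear implicits.

Lemma cell_prob_ge0 N k a : 0 <= cell_prob N k a.
Proof.
apply: mean_ge0; first exact/ess_bounded_indic/measurable_cell_event.
by apply: aeW => w; rewrite indicE.
Qed.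

Lemma mean_sum_cells N k (f : Omega -> R) : ess_bounded P f ->
  \sum_a mean P (fun w => \1_[set w | cell N (Y k w) = a] w * f w) = mean P f.
Proof.
move=> bf; rewrite -mean_sum; last first.
  by move=> a; apply: ess_boundedM => //;
    exact/ess_bounded_indic/measurable_cell_event.
congr mean; apply/funext => w.
exact: (sum_indic_fiber (fun w => cell N (Y k w)) (fun=> f w)).
Qed.

Lemma cell_prob_sum1 N k : \sum_a cell_prob N k a = 1.
Proof.
rewrite -(mean_cst P 1) -(mean_sum_cells N k (ess_bounded_cst P 1)).
by apply: eq_bigr => a _; congr mean; apply/funext => w; rewrite mulr1.
Qed.

(** Law of total expectation over the cells. *)
Lemma cell_mean_centered N k : expectation_mx P (Y k) = 0 ->
  \sum_a (cell_prob N k a)%:C%C *: cell_mean N k a = 0.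
Proof.
move=> Y0.
have be := cess_bounded_entry k.
have mS := measurable_cell_event (N := N) k.
under eq_bigr => a _ do rewrite (scale_cond_mean (mS a) be).
rewrite -[RHS]Y0; apply/matrixP => i j; rewrite summxE [RHS]mxE.
under eq_bigr do rewrite mxE.
rewrite -cmean_sum; last first.
  by move=> a; apply: cess_boundedM => //; exact: cess_bounded_indic.
have -> : (fun w => \sum_a (\1_[set w | cell N (Y k w) = a] w)%:C%C * Y k w i j) =
    (fun w => Y k w i j).
  apply/funext => w; rewrite -mulr_suml -rmorph_sum /=.
  under eq_bigr do rewrite -[\1_ _ _]mulr1.
  by rewrite (sum_indic_fiber (fun w => cell N (Y k w)) (fun=> 1)) mul1r.
by [].
Qed.

Lemma qf_expectation_sq k x :
  qf x (expectation_mx P (fun w => Y k w *m Y k w)) =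
  mean P (fun w => nrm2 (x *m Y k w)).
Proof.
have be i j : cess_bounded P (fun w => (Y k w *m Y k w) i j).
  under eq_fun do rewrite mxE; apply: cess_bounded_sum => l.
  by apply: cess_boundedM; exact: cess_bounded_entry.
have -> : (fun w => nrm2 (x *m Y k w)) = (fun w => complex.Re (\sum_i \sum_j
    (x 0 i * Num.conj (x 0 j)) * (Y k w *m Y k w) i j)).
  apply/funext => w; rewrite -qf_sq // qf_expand Re_sum.
  by apply: eq_bigr => i _; rewrite Re_sum; apply: eq_bigr => j _; rewrite mulrC.
transitivity (complex.Re (cmean P (fun w => \sum_i \sum_j
    (x 0 i * Num.conj (x 0 j)) * (Y k w *m Y k w) i j))); last by [].
have bc i j : cess_bounded P
    (fun w => x 0 i * Num.conj (x 0 j) * (Y k w *m Y k w) i j).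
  exact: cess_boundedM (cess_bounded_cst _ _) (be i j).
rewrite cmean_sum; last by move=> i; exact: cess_bounded_sum.
rewrite qf_expand Re_sum; apply: eq_bigr => i _.
rewrite cmean_sum // Re_sum; apply: eq_bigr => j _.
by rewrite cmeanZ // mulrC /expectation_mx mxE.
Qed.

Lemma expectation_sq_herm k :
  (expectation_mx P (fun w => Y k w *m Y k w))^t* =
  expectation_mx P (fun w => Y k w *m Y k w).
Proof.
have be i j : cess_bounded P (fun w => (Y k w *m Y k w) i j).
  under eq_fun do rewrite mxE; apply: cess_bounded_sum => l.
  by apply: cess_boundedM; exact: cess_bounded_entry.
apply/matrixP => i j; rewrite !mxE.
transitivity (Num.conj (cmean P (fun w => (Y k w *m Y k w) j i))); first by [].
rewrite -cmean_conj //; transitivity (cmean P (fun w => (Y k w *m Y k w) i j)) => //.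
congr cmean; apply/funext => w.
by rewrite -[in RHS](herm_sq (Y_herm k w)) [RHS]mxE [in RHS]mxE.
Qed.

Lemma ess_bounded_nrm2 k x : ess_bounded P (fun w => nrm2 (x *m Y k w)).
Proof.
apply: ess_bounded_sum => j; apply: ess_bounded_sqn.
under eq_fun do rewrite mxE; apply: cess_bounded_sum => i.
exact: cess_boundedM (cess_bounded_cst _ _) (cess_bounded_entry _ _ _).
Qed.

Lemma cell_mean_herm N k a : (cell_mean N k a)^t* = cell_mean N k a.
Proof.
apply: cond_mean_herm; [exact: measurable_cell_event|exact: cess_bounded_entry|].
exact: Y_herm.
Qed.

Lemma cell_mean_nrm2_le N k a x :
  cell_prob N k a * nrm2 (x *m cell_mean N k a) <=
  mean P (fun w => \1_[set w | cell N (Y k w) = a] w * nrm2 (x *m Y k w)).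
Proof.
apply: nrm2_cond_mean_le; [exact: measurable_cell_event|exact: cess_bounded_entry].
Qed.

Lemma cell_mean_null N k a : cell_prob N k a = 0 -> cell_mean N k a = 0.
Proof.
by rewrite /cell_prob => p0; apply/matrixP => i j; rewrite !mxE p0 invr0 mul0r.
Qed.

(** Jensen's inequality on a cell of positive probability; on a null cell the junk value 0 satisfies
    the bound. *)
Lemma cell_mean_bound N k a :
  psd ((L ^+ 2)%:C%C%:M - cell_mean N k a *m cell_mean N k a).
Proof.
move=> x; rewrite qfB qf_scalar qf_sq; last exact: cell_mean_herm.
rewrite subr_ge0.
have := cell_prob_ge0 k a; rewrite le_eqVlt => /predU1P[/esym p0|p_gt0].
  rewrite cell_mean_null // mulmx0 /nrm2 big1 ?mulr_ge0 ?sqr_ge0 ?nrm2_ge0 //.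
  by move=> j _; rewrite mxE (sqn_real 0) expr0n.
have mS := measurable_cell_event (N := N) k a.
rewrite -(ler_pM2l p_gt0); apply: (le_trans (cell_mean_nrm2_le _ _ _)).
rewrite mulrC /cell_prob -meanZ; last exact: ess_bounded_indic.
apply: ler_mean.
- by apply: ess_boundedM; [exact: ess_bounded_indic|exact: ess_bounded_nrm2].
- by apply: ess_boundedZ; exact: ess_bounded_indic.
apply: filterS (Y_bounded k) => w Yw; rewrite mulrC ler_wpM2r ?indicE //.
exact: nrm2_le_of_psd.
Qed.

(** Jensen's inequality on each cell, summed over the cells: conditioning does not increase the
    variance. *)
Lemma cell_mean_var N (s2 : R) :
  psd (s2%:C%C%:M - \sum_k expectation_mx P (fun w => Y k w *m Y k w)) ->
  psd (s2%:C%C%:M - \sum_k \sum_a (cell_prob N k a)%:C%C *: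
    (cell_mean N k a *m cell_mean N k a)).
Proof.
move=> H x; have := H x; rewrite !qfB !subr_ge0 => /(le_trans _); apply.
rewrite !qf_sum; apply: ler_sum => k _; rewrite qf_sum qf_expectation_sq.
rewrite -(mean_sum_cells N k (ess_bounded_nrm2 k x)); apply: ler_sum => a _.
rewrite qfZ qf_sq; last exact: cell_mean_herm.
exact: cell_mean_nrm2_le.
Qed.

Hypothesis Y_indep : mutually_independent P Y.

(** Independence enters here: the joint law of the cells is the product law of the finite model. *)
Lemma mean_cells_event N x :
  mean P (\1_[set w | cells N w = x]) = weight (cell_prob N) x.
Proof.
rewrite mean_indic; last exact: measurable_cells_event.
rewrite cells_eventE Y_indep; last by move=> k; exact: measurable_cell.
rewrite /weight [X in fine X](eq_bigl xpredT); last by move=> k; rewrite finset.in_setT.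
rewrite (eq_bigr (fun k => (cell_prob N k (x k))%:E)) => [|k _]; last first.
  rewrite /cell_prob mean_indic; last exact: measurable_cell_event.
  by rewrite fineK // fin_num_measure //; exact: measurable_cell_event.
by rewrite prodEFin.
Qed.

(** A conditional mean is as close to [Y k w] as the whole cell is. A null cell would contribute the
    junk value 0, whence the last hypothesis. *)
Lemma lambda_max_cells_le N w : L < N.+1%:R ->
  (forall k, psd ((L ^+ 2)%:C%C%:M - Y k w *m Y k w)) ->
  (forall k, 0 < cell_prob N k (cell N (Y k w))) ->
  lambda_max (\sum_k Y k w) <= lambda_max (total (cell_mean N) (cells N w)) +
    2 * (n%:R * N.+1%:R^-1) * d%:R ^+ 2.
Proof.
move=> LN Yw pw; apply: lambda_max_sum_le => //.
  by move=> k; exact: cell_mean_herm.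
move=> k b i j; rewrite ffunE distrC; apply: cond_mean_close.
- exact: measurable_cell_event.
- exact: cess_bounded_entry.
- exact: pw.
- move=> w' /= ww'; apply: cell_close; first by rewrite ww'.
  by apply: le_lt_trans LN; exact: part_le_of_psd.
Qed.

Lemma mgf_lambda_max_cells_le N th : 0 <= th -> L < N.+1%:R ->
  mean P (fun w => expR (th * lambda_max (\sum_k Y k w))) <=
  expR (th * (2 * (n%:R * N.+1%:R^-1) * d%:R ^+ 2)) *
  mgf (cell_prob N) (cell_mean N) th.
Proof.
move=> th0 LN; set f := fun w => _; set e := 2 * _ * _.
have bf : ess_bounded P f.
  by apply/ess_bounded_expR/ess_boundedZ; exact: ess_bounded_lambda_max_sum.
have bS x : ess_bounded P (\1_[set w | cells N w = x]).
  exact/ess_bounded_indic/measurable_cells_event.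
have -> : mean P f = \sum_x mean P (fun w => \1_[set w | cells N w = x] w * f w).
  rewrite -mean_sum; last by move=> x; exact: ess_boundedM.
  congr mean; apply/funext => w.
  by rewrite (sum_indic_fiber (cells N) (fun=> f w)).
rewrite /mgf mulr_sumr; apply: ler_sum => x _.
have w0 := weight_ge0 (cell_prob_ge0 (N := N)) x.
move: w0; rewrite le_eqVlt => /predU1P[wx0|wx_gt0].
  (* A null tuple of cells contributes nothing to the mean, by Cauchy-Schwarz. *)
  rewrite -wx0 mul0r mulr0.
  have := mean_indic_sqr_le (measurable_cells_event (N := N) x) bf.
  rewrite mean_cells_event -wx0 mul0r => h.
  have : mean P (fun w => \1_[set w | cells N w = x] w * f w) ^+ 2 == 0.
    by rewrite eq_le sqr_ge0 andbT h.
  by rewrite sqrf_eq0 => /eqP ->.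
have px k : 0 < cell_prob N k (x k).
  rewrite lt_def cell_prob_ge0 andbT; apply: contraTneq wx_gt0 => p0.
  by rewrite /weight (bigD1 k) //= p0 mul0r ltxx.
rewrite mulrCA -mean_cells_event mulrC -meanZ //; apply: ler_mean.
- exact: ess_boundedM.
- exact: ess_boundedZ.
apply: filterS Y_good => w Yw; rewrite indicE.
have [/set_mem /= wx|_] := boolP (w \in _); last by rewrite mul0r mulr0.
rewrite mul1r mulr1 /f.
apply: (@le_trans _ _ (expR (th * (lambda_max (total (cell_mean N) x) + e)))).
  rewrite ler_expR ler_wpM2l // -wx; apply: lambda_max_cells_le => // k.
  by have := px k; rewrite -wx ffunE.
rewrite mulrDr expRD mulrC ler_wpM2l ?expR_ge0 // expR_lambda_max_le //.
by apply: total_herm => k a; exact: cell_mean_herm.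
Qed.

Theorem matrix_mgf_le (s2 th : R) :
  (forall k, expectation_mx P (Y k) = 0) -> 0 <= s2 ->
  psd (s2%:C%C%:M - \sum_k expectation_mx P (fun w => Y k w *m Y k w)) ->
  0 <= th -> th * L < 1 ->
  mean P (fun w => expR (th * lambda_max (\sum_k Y k w))) <=
  d%:R * expR (th ^+ 2 * s2 / (2 * (1 - th * L))).
Proof.
move=> Y0 s0 Hs th0 tL; apply: ler_of_expR_factor.
  by rewrite mulr_gt0 ?ltr0n ?expR_gt0.
move=> e e0; pose D : R := 2 * n%:R * d%:R ^+ 2 * th.
have D0 : 0 <= D by rewrite /D !mulr_ge0.
(* This N puts L inside the grid and makes the error D / (N + 1) at most e. *)
have [N NN] : exists N : nat, L + D / e < N.+1%:R.
  by exists (Num.truncn (L + D / e)); exact: truncnS_gt.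
have De : 0 <= D / e by rewrite divr_ge0 // ltW.
have LN : L < N.+1%:R by apply: le_lt_trans NN; rewrite lerDl.
apply: (le_trans (mgf_lambda_max_cells_le th0 LN)).
apply: ler_pM; rewrite ?expR_ge0 //.
- apply: sumr_ge0 => x _; rewrite mulr_ge0 ?weight_ge0 //.
    by move=> k a; exact: cell_prob_ge0.
  by apply: trexp_ge0 => y; rewrite qf1 nrm2_ge0.
- rewrite ler_expR.
  have -> : th * (2 * (n%:R * N.+1%:R^-1) * d%:R ^+ 2) = D / N.+1%:R.
    by rewrite /D; ring.
  have DN : D / e <= N.+1%:R by apply: ltW; apply: le_lt_trans NN; rewrite lerDr.
  by rewrite ler_pdivrMr ?ltr0n // mulrC -ler_pdivrMr.
apply: finite_mgf_le => //.
- exact: cell_prob_ge0.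
- exact: cell_prob_sum1.
- exact: cell_mean_herm.
- by move=> k; exact: cell_mean_centered.
- exact: cell_mean_bound.
- exact: cell_mean_var.
Qed.

End MatrixMgf.

(** * The Laplace transform method *)

Section ExponentialMoments.
Context {disp : measure_display} {Omega : measurableType disp} {R : realType}.
Variables (P : probability Omega R) (f : Omega -> R).
Hypothesis bf : ess_bounded P f.

Lemma measurable_ge_event (t : R) : measurable [set w | t <= f w].
Proof.
have := bf.1 measurableT `[t, +oo[%classic (measurable_itv _).
rewrite setTI; congr measurable; apply/seteqP; split => w /=;
  by rewrite in_itv /= andbT.
Qed.

Lemma markov_expR (th t : R) : 0 <= th ->
  fine (P [set w | t <= f w]) <=
  expR (- (th * t)) * mean P (fun w => expR (th * f w)).
Proof.
move=> th0; have mt := measurable_ge_event t.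
have be : ess_bounded P (fun w => expR (th * f w)).
  exact/ess_bounded_expR/ess_boundedZ.
rewrite -mean_indic // -meanZ //; apply: ler_mean.
- exact: ess_bounded_indic.
- exact: ess_boundedZ.
apply: aeW => w; rewrite indicE -expRD.
have [/set_mem /= tf|_] := boolP (w \in _); last exact: expR_ge0.
(* On the event, exp(th (f - t)) >= 1 + th (f - t) >= 1. *)
apply: le_trans (expR_ge1Dx _); rewrite lerDl addrC subr_ge0.
exact: ler_wpM2l.
Qed.

(** Jensen's inequality by the tangent of exp at ln K: th f + 1 - ln K <= exp(th f) / K, and the
    right side has mean at most 1. *)
Lemma mean_le_ln_mgf (th K : R) : 0 < K -> mean P (fun w => expR (th * f w)) <= K ->
  th * mean P f <= ln K.
Proof.
move=> K0 HK; have be : ess_bounded P (fun w => expR (th * f w)).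
  exact/ess_bounded_expR/ess_boundedZ.
have bc := ess_bounded_cst P (1 - ln K).
have bt := ess_boundedZ th bf.
have : mean P (fun w => th * f w + (1 - ln K)) <=
    mean P (fun w => K^-1 * expR (th * f w)).
  apply: ler_mean; [exact: ess_boundedD|exact: ess_boundedZ|].
  apply: aeW => w; have := expR_ge1Dx (th * f w - ln K).
  by rewrite expRB lnK // (mulrC (expR _)); apply: le_trans; rewrite addrCA.
rewrite meanD // !meanZ // (mean_cst P (1 - ln K)) => h.
have : K^-1 * mean P (fun w => expR (th * f w)) <= 1.
  by rewrite mulrC ler_pdivrMr // mul1r.
by move: h; lra.
Qed.

Variables (d : nat) (L s : R).
Hypothesis d_gt0 : (0 < d)%N.
Hypothesis L_ge0 : 0 <= L.
Hypothesis s_ge0 : 0 <= s.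
Hypothesis mgf_le : forall th : R, 0 <= th -> th * L < 1 ->
  mean P (fun w => expR (th * f w)) <=
  d%:R * expR (th ^+ 2 * s / (2 * (1 - th * L))).

Lemma bernstein_tail_nondegenerate (t : R) : 0 <= t -> 0 < s + L * t ->
  fine (P [set w | t <= f w]) <= d%:R * expR (- t ^+ 2 / (3 * s + 2 * L * t)).
Proof.
move=> t0 D0; have Lt0 : 0 <= L * t by rewrite mulr_ge0.
have E0 : 0 < s + 2 * (L * t) by lra.
(* The optimiser t / (s + L t) satisfies th L < 1 only for s > 0; this choice
   gives the same exponent -t^2 / (2 (s + L t)) and is always admissible. *)
pose th := t / (s + 2 * (L * t)).
have th0 : 0 <= th by rewrite divr_ge0 // ltW.
have thL : 1 - th * L = (s + L * t) / (s + 2 * (L * t)).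
  by rewrite /th; field; rewrite gt_eqF.
have thL1 : th * L < 1 by rewrite -subr_gt0 thL divr_gt0.
apply: (le_trans (markov_expR t th0)).
have := ler_wpM2l (expR_ge0 (- (th * t))) (mgf_le th0 thL1).
move=> /le_trans; apply; rewrite mulrCA -expRD thL ler_wpM2l // ler_expR.
have -> : - (th * t) +
    th ^+ 2 * s / (2 * ((s + L * t) / (s + 2 * (L * t)))) =
    - (t ^+ 2 / (2 * (s + L * t))).
  by rewrite /th; field; rewrite !gt_eqF.
(* The exponent obtained has denominator 2 s + 2 L t, here weakened to 3 s + 2 L t. *)
rewrite mulNr lerN2 ler_wpM2l ?sqr_ge0 // -(mulrA 2 L t).
move: (L * t) Lt0 D0 s_ge0 => x x0 D0 s0.
by rewrite lef_pV2 ?posrE; lra.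
Qed.

(** The moment bound is now d for every th >= 0, so p <= d exp(-th t). A positive p is refuted by th
    = d / (p t), since p exp(d / p) >= p + d > d. *)
Lemma bernstein_tail_null (t : R) : 0 < t -> s = 0 -> L = 0 ->
  fine (P [set w | t <= f w]) = 0.
Proof.
move=> t0 s0 L0; apply/eqP; rewrite eq_le fine_ge0 // andbT leNgt.
apply/negP; set p := fine _ => p0.
have d0 : (0 : R) < d%:R by rewrite ltr0n.
have pt0 : 0 < p * t by rewrite mulr_gt0.
have th0 : 0 <= d%:R / (p * t) by rewrite divr_ge0 // ltW.
have := markov_expR t th0; rewrite -/p.
have := mgf_le th0; rewrite L0 mulr0 ltr01 => /(_ isT).
rewrite s0 mulr0 mul0r expR0 mulr1 => h1 h2.
have := le_trans h2 (ler_wpM2l (expR_ge0 _) h1).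
rewrite expRN mulrC ler_pdivlMr ?expR_gt0 // leNgt => /negP; apply.
have h3 := expR_ge1Dx (d%:R / (p * t) * t).
apply: (lt_le_trans _ (ler_wpM2l (ltW p0) h3)).
have -> : p * (1 + d%:R / (p * t) * t) = p + d%:R.
  by field; rewrite !gt_eqF.
by rewrite ltrDr.
Qed.

Lemma bernstein_tail (t : R) : 0 <= t ->
  (P [set w | (t <= f w)%R] <=
   d%:R%:E * expeR ((- t ^+ 2)%:E / (3 * s + 2 * L * t)%:E))%E.
Proof.
move=> t0; have Pfin : P [set w | t <= f w] \is a fin_num.
  by rewrite fin_num_measure //; exact: measurable_ge_event.
have Lt0 : 0 <= L * t by rewrite mulr_ge0.
have [D0|D0] := ltP 0 (s + L * t).
  rewrite -(fineK Pfin) inver gt_eqF; last first.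
    by rewrite -(mulrA 2 L t); move: s_ge0 Lt0 D0; lra.
  by rewrite -EFinM /= lee_fin; exact: bernstein_tail_nondegenerate.
have s0 : s = 0 by move: s_ge0 Lt0 D0; lra.
have Lt : L * t = 0 by move: s_ge0 Lt0 D0; lra.
rewrite s0 -mulrA Lt !mulr0 addr0 inve0.
(* The inverse of 0 is +oo. At t = 0 the exponent is 0 * +oo = 0 and the bound is d >= 1; for t > 0
   it is -oo and the bound is 0. *)
move: t0; rewrite le_eqVlt => /predU1P[<-|t_gt0].
  rewrite expr0n oppr0 mul0e expeR0 mule1.
  apply: le_trans (probability_le1 _ (measurable_ge_event _)) _.
  by rewrite lee_fin ler1n.
have L0 : L = 0.
  by apply/eqP; move/eqP: Lt; rewrite mulf_eq0 (gt_eqF t_gt0) orbF.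
have -> : ((- t ^+ 2)%:E * +oo = -oo)%E.
  by rewrite lt0_muley // lte_fin oppr_lt0 exprn_gt0.
by rewrite -(fineK Pfin) bernstein_tail_null //= mule0.
Qed.

Lemma bernstein_mean_param (u : R) : 0 < u ->
  mean P f <= ln d%:R / u + L * ln d%:R + u * s / 2.
Proof.
move=> u0; have Lu0 : 0 <= L * u by rewrite mulr_ge0 // ltW.
have E0 : 0 < 1 + L * u by lra.
(* This substitution separates the terms: 1 / th = 1 / u + L and th / (1 - th L) = u. *)
pose th := u / (1 + L * u).
have th_gt0 : 0 < th by rewrite divr_gt0.
have thL : 1 - th * L = (1 + L * u)^-1 by rewrite /th; field; rewrite gt_eqF.
have thL1 : th * L < 1 by rewrite -subr_gt0 thL invr_gt0.
have d0 : (0 : R) < d%:R by rewrite ltr0n.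
have := mean_le_ln_mgf _ (mgf_le (ltW th_gt0) thL1).
rewrite mulr_gt0 ?expR_gt0 // => /(_ isT).
rewrite lnM ?posrE ?expR_gt0 // expRK thL => h.
rewrite -(ler_pM2l th_gt0); apply: (le_trans h).
rewrite le_eqVlt; apply/orP; left; apply/eqP; rewrite /th; field.
by rewrite !gt_eqF.
Qed.

Lemma bernstein_mean :
  mean P f <= Num.sqrt s * Num.sqrt (3 * ln d%:R) + L * ln d%:R.
Proof.
have l0 : 0 <= ln d%:R :> R by rewrite ln_ge0 // ler1n.
set a := Num.sqrt s; set b := Num.sqrt _.
have a0 : 0 <= a := sqrtr_ge0 _; have b0 : 0 <= b := sqrtr_ge0 _.
have sE : s = a ^+ 2 by rewrite sqr_sqrtr.
have lE : ln d%:R = b ^+ 2 / 3 by rewrite sqr_sqrtr ?mulr_ge0 //; field.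
have H u : 0 < u -> mean P f - L * ln d%:R <= b ^+ 2 / 3 / u + u * a ^+ 2 / 2.
  by move=> u0; have := bernstein_mean_param u0; rewrite -lE -sE; lra.
rewrite -lerBlDr; move: H; set m := _ - _ => H.
move: a0 b0; rewrite [0 <= a]le_eqVlt [0 <= b]le_eqVlt => /predU1P[a0|a0] /predU1P[b0|b0].
(* If a or b vanishes, no u > 0 is optimal; when exactly one does, u is chosen from a supposed m > 0
   so that m is bounded by a proper fraction of itself. *)
- by have := H 1 ltr01; rewrite -a0 -b0 expr0n /= !(mul0r, mulr0) addr0 => ->.
- rewrite -a0 mul0r leNgt; apply/negP => m0.
  have b2 : 0 < b ^+ 2 by rewrite exprn_gt0.
  have /H : 0 < b ^+ 2 / m by rewrite divr_gt0.
  have -> : b ^+ 2 / 3 / (b ^+ 2 / m) + b ^+ 2 / m * a ^+ 2 / 2 = m / 3.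
    by rewrite -a0; field; rewrite !gt_eqF.
  by lra.
- rewrite -b0 mulr0 leNgt; apply/negP => m0.
  have a2 : 0 < a ^+ 2 by rewrite exprn_gt0.
  have /H : 0 < m / a ^+ 2 by rewrite divr_gt0.
  have -> : b ^+ 2 / 3 / (m / a ^+ 2) + m / a ^+ 2 * a ^+ 2 / 2 = m / 2.
    by rewrite -b0; field; rewrite !gt_eqF.
  by lra.
(* Not the exact minimiser, but its value 5/6 a b suffices. *)
- have /H : 0 < b / a by rewrite divr_gt0.
  have -> : b ^+ 2 / 3 / (b / a) + b / a * a ^+ 2 / 2 = a * b * (5 / 6).
    by field; rewrite !gt_eqF.
  have : 0 < a * b by rewrite mulr_gt0.
  by lra.
Qed.

End ExponentialMoments.

(* Quotient and exponential of the tail bound are taken in the extended reals: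
   when 3 sigma^2 + 2 L t = 0 < t, the exponent is -oo and the bound is 0. *)
Theorem corollary5p2 (R : realType) (disp : measure_display)
    (Omega : measurableType disp) (P : probability Omega R)
    (d : nat) (d_gt0 : (0 < d)%N) (n : nat)
    (Y : 'I_n -> {RV P >-> 'M[R[i]]_d})
    (Y_hermitian : forall k w, Y k w \is hermsymmx)
    (Y_independent : mutually_independent P Y)
    (L : R) (L_ge0 : 0 <= L)
    (Y_centered : forall k, expectation_mx P (Y k) = 0)
    (Y_bounded : forall k, {ae P, forall w, spectral_norm (Y k w) <= L}) :
  let sigma2 :=
    spectral_norm (\sum_k expectation_mx P (fun w => Y k w *m Y k w)) in
  (forall t : R, 0 <= t ->
    (P [set w | (t <= lambda_max (\sum_k Y k w))%R] <=
     d%:R%:E * expeR ((- t ^+ 2)%:E / (3 * sigma2 + 2 * L * t)%:E))%E) /\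
  ('E_P[fun w => lambda_max (\sum_k Y k w)] <=
   (Num.sqrt sigma2 * Num.sqrt (3 * ln d%:R) + L * ln d%:R)%:E)%E.
Proof.
move=> sigma2.
have hY k w : (Y k w)^t* = Y k w by exact/hermP.
have bY k : {ae P, forall w, psd ((L ^+ 2)%:C%C%:M - Y k w *m Y k w)}.
  by apply: filterS (Y_bounded k) => w; exact: spectral_norm_le_psd.
have hV : (\sum_k expectation_mx P (fun w => Y k w *m Y k w))^t* =
    \sum_k expectation_mx P (fun w => Y k w *m Y k w).
  by apply: herm_sum => k; exact: expectation_sq_herm bY k.
have s0 : 0 <= sigma2 := sqrtr_ge0 _.
have mgfY th : 0 <= th -> th * L < 1 ->
    mean P (fun w => expR (th * lambda_max (\sum_k Y k w))) <=
    d%:R * expR (th ^+ 2 * sigma2 / (2 * (1 - th * L))).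
  apply: matrix_mgf_le => //; exact: psd_spectral_norm.
have bl := ess_bounded_lambda_max_sum d_gt0 hY L_ge0 bY.
split=> [t t0|]; first exact: bernstein_tail.
by rewrite mean_fin // lee_fin; exact: bernstein_mean.
Qed.
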